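(* The function $F_{sing}$ belongs to $L^1_{loc}(\mathfrak q)^H$, i.e. it is an $H$-invariant locally integrable function on $\mathfrak q$.
   Context: $H=\{\mathrm{diag}(A,B):A,B\in GL(2,\mathbb R)\}$ (block diagonal) acts by conjugation on $\mathfrak q=\{X=\begin{pmatrix}0&U\\ V&0\end{pmatrix}:U,V\in M_2(\mathbb R)\}$. Put $Q(X)=\frac12\mathrm{tr}(X^2)$, $S(X)=\det X$, $S_0=Q^2-4S$; $\delta=\sqrt{S_0}$ if $S_0\ge0$, $\delta=i\sqrt{|S_0|}$ if $S_0<0$; $u=\frac{Q+\delta}2$, $v=\frac{Q-\delta}2$. Fix $\lambda_1,\lambda_2\in\mathbb C$ with $\lambda_1\lambda_2(\lambda_1-\lambda_2)\ne0$. For $\lambda\in\mathbb C^*$: $\Phi_\lambda(z)=\sum_{n\ge0}\frac{(\lambda z)^n}{4^n(n!)^2}$, $w_\lambda(z)=\sum_{n\ge0}\frac{a(n)(\lambda z)^n}{4^n(n!)^2}$ with $a(x)=-2\frac{\Gamma'(x+1)}{\Gamma(x+1)}$. With $[f,g](x_1,x_2)=f(x_1)g(x_2)-f(x_2)g(x_1)$, define almost everywhere on $\mathfrak q$ (on $\{SS_0\ne0\}$) $$F_{sing}=\frac{[\Phi_{\lambda_1},w_{\lambda_2}](u,v)+[w_{\lambda_1},\Phi_{\lambda_2}](u,v)}{u-v}+\log|uv|\,\frac{[\Phi_{\lambda_1},\Phi_{\lambda_2}](u,v)}{u-v}.$$ *)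

(* Defs.v *)
From HB Require Import structures.
From mathcomp Require Import all_boot all_order all_algebra.
From mathcomp Require Import complex.
From mathcomp Require Import all_classical all_reals all_analysis.

Set Implicit Arguments.
Unset Strict Implicit.
Unset Printing Implicit Defensive.

Import Order.TTheory GRing.Theory Num.Theory.
Import numFieldNormedType.Exports.

Local Open Scope classical_set_scope.
Local Open Scope complex_scope.
Local Open Scope ring_scope.

Definition Gamma (R : realType) (x : R) : R :=
  \int[@lebesgue_measure R]_(t in `]0, +oo[) (t `^ (x - 1) * expR (- t)).

Definition acoef (R : realType) (x : R) : R :=
  - 2 * (derive1 (@Gamma R) (x + 1) / Gamma (x + 1)).

(* The ascription to [R[i]^o] selects the topology given by the modulus. *)
Definition csum (R : realType) (c : nat -> R[i]) : R[i] :=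
  limn (series c : nat -> R[i]^o).

Definition Phi (R : realType) (lambda z : R[i]) : R[i] :=
  csum (fun n => (lambda * z) ^+ n / (4 ^+ n * (n`!%:R) ^+ 2)).

Definition wser (R : realType) (lambda z : R[i]) : R[i] :=
  csum (fun n =>
    (acoef (n%:R : R))%:C * (lambda * z) ^+ n / (4 ^+ n * (n`!%:R) ^+ 2)).

Definition bracket (R : realType) (f g : R[i] -> R[i]) (x1 x2 : R[i]) : R[i] :=
  f x1 * g x2 - f x2 * g x1.

Definition cabs (R : realType) (z : R[i]) : R := complex.Re `|z|.

Definition Hgrp (R : realType) : set 'M[R]_(2 + 2) :=
  [set h | exists A B : 'M[R]_2,
    [/\ A \in unitmx, B \in unitmx & h = block_mx A 0 0 B]].

Definition qspace (R : realType) : set 'M[R]_(2 + 2) :=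
  [set X | exists U V : 'M[R]_2, X = block_mx 0 U V 0].

Section invariants.
Variables (R : realType) (X : 'M[R]_(2 + 2)).

Definition Qinv : R := \tr (X *m X) / 2.
Definition Sinv : R := \det X.
Definition S0inv : R := Qinv ^+ 2 - 4 * Sinv.

Definition delta : R[i] :=
  if 0 <= S0inv then (Num.sqrt S0inv)%:C
  else 'i%C * (Num.sqrt `|S0inv|)%:C.

Definition uinv : R[i] := (Qinv%:C + delta) / 2.
Definition vinv : R[i] := (Qinv%:C - delta) / 2.

End invariants.

Definition qreg (R : realType) : set 'M[R]_(2 + 2) :=
  [set X | qspace X /\ Sinv X * S0inv X != 0].

(* Only the values on [qreg] are meaningful. *)
Definition Fsing (R : realType) (lambda1 lambda2 : R[i])
    (X : 'M[R]_(2 + 2)) : R[i] :=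
  let u := uinv X in let v := vinv X in
  (bracket (Phi lambda1) (wser lambda2) u v
   + bracket (wser lambda1) (Phi lambda2) u v) / (u - v)
  + (ln (cabs (u * v)))%:C
    * (bracket (Phi lambda1) (Phi lambda2) u v / (u - v)).

(* The library has no canonical sigma-finiteness instance for a product of
   sigma-finite measures in general. *)
Lemma product_sigma_finite (d1 d2 : measure_display) (T1 : measurableType d1)
    (T2 : measurableType d2) (R : realType)
    (m1 : {sigma_finite_measure set T1 -> \bar R})
    (m2 : {sigma_finite_measure set T2 -> \bar R}) :
  sigma_finite setT (m1 \x m2)%E.
Proof.
have /sigma_finiteP[F [TF ndF Foo]] := sigma_finiteT m1.
have /sigma_finiteP[G [TG ndG Goo]] := sigma_finiteT m2.
exists (fun n => F n `*` G n).
  rewrite -setXTT TF TG predeqE => -[x y]; split.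
    move=> [/= [n _ Fnx] [k _ Gky]]; exists (maxn n k) => //; split.
    - by move: x Fnx; exact/subsetPset/ndF/leq_maxl.
    - by move: y Gky; exact/subsetPset/ndG/leq_maxr.
  by move=> [n _ []/= ? ?]; split; exists n.
move=> k; have [? ?] := Foo k; have [? ?] := Goo k.
split; first exact: measurableX.
by rewrite product_measure1E// lte_mul_pinfty// ge0_fin_numE.
Qed.

Section lebesgue8.
Variable R : realType.
Local Notation BR := (measurableTypeR R).

Definition leb2 : set (BR * BR)%type -> \bar R :=
  (@lebesgue_measure R \x @lebesgue_measure R)%E.
HB.instance Definition _ := Measure.on leb2.
HB.instance Definition _ := Measure_isSigmaFinite.Build _ _ _ leb2
  (product_sigma_finite (@lebesgue_measure R) (@lebesgue_measure R)).

Definition leb4 : set ((BR * BR) * (BR * BR))%type -> \bar R :=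
  (leb2 \x leb2)%E.
HB.instance Definition _ := Measure.on leb4.
HB.instance Definition _ := Measure_isSigmaFinite.Build _ _ _ leb4
  (product_sigma_finite leb2 leb2).

Definition leb8 :
    set (((BR * BR) * (BR * BR)) * ((BR * BR) * (BR * BR)))%type -> \bar R :=
  (leb4 \x leb4)%E.
HB.instance Definition _ := Measure.on leb8.
HB.instance Definition _ := Measure_isSigmaFinite.Build _ _ _ leb8
  (product_sigma_finite leb4 leb4).

End lebesgue8.

(* Coordinates [(U, V)] on [qspace], a 2 x 2 matrix being listed by rows as
   [((m00, m01), (m10, m11))]; [measurableTypeR R] is [R] with the Borel sets. *)
Notation qcoord R :=
  (((measurableTypeR R * measurableTypeR R)
    * (measurableTypeR R * measurableTypeR R))
   * ((measurableTypeR R * measurableTypeR R)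
      * (measurableTypeR R * measurableTypeR R)))%type.

Definition mx2 (R : realType) (m : (R * R) * (R * R)) : 'M[R]_2 :=
  \matrix_(i, j)
    let r := if i == 0 then m.1 else m.2 in if j == 0 then r.1 else r.2.

Definition qmx (R : realType) (p : qcoord R) : 'M[R]_(2 + 2) :=
  block_mx 0 (mx2 p.1) (mx2 p.2) 0.

(* For a function on [qspace] defined almost everywhere, with domain [D]. The
   conjunct [measurable] is not redundant: [measurable_fun] presupposes it. *)
Definition L1loc (R : realType) (D : set 'M[R]_(2 + 2))
    (F : 'M[R]_(2 + 2) -> R[i]) : Prop :=
  let E : set (qcoord R) := @qmx R @^-1` D in
  [/\ measurable E,
      (@leb8 R).-negligible (~` E),
      measurable_fun E (fun p : qcoord R => complex.Re (F (qmx p))),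
      measurable_fun E (fun p : qcoord R => complex.Im (F (qmx p)))
    & forall K : set (qcoord R),
      compact (K : set (((R * R) * (R * R)) * ((R * R) * (R * R)))%type) ->
      (\int[@leb8 R]_(p in K `&` E) (cabs (F (qmx p)))%:E < +oo)%E].

(* [D] is the domain of [F]; the group acts by conjugation. *)
Definition Hinvariant (R : realType) (D : set 'M[R]_(2 + 2))
    (F : 'M[R]_(2 + 2) -> R[i]) : Prop :=
  forall h X, Hgrp h -> D X ->
    D (h *m X *m invmx h) /\ F (h *m X *m invmx h) = F X.

(* Main.v *)
(* On the domain, [uinv * vinv = Sinv] and [uinv - vinv = delta <> 0].  An
   antisymmetric bracket of two entire functions vanishes on the diagonal, so
   its quotient by [u - v] is locally bounded, and near any point [Fsing] is
   dominated by [1 + |ln |S||], hence by a multiple of [|S|^(-1/2)] where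
   [S = det U * det V] in coordinates.  Since [|ad - bc| = |a| |d - bc/a|] and
   [|x - e|^(-1/2)] has integral over an interval bounded uniformly in [e],
   Tonelli's theorem gives the integrability of [|det|^(-1/2)] on boxes.
   Entireness of [wser] only needs a crude factorial bound on [acoef n], obtained
   by dominating the difference quotients of the integrand of [Gamma].  The set
   [S * S0 = 0] is null because almost all its one-dimensional sections are
   zero sets of nonzero polynomials.  Invariance holds because [Fsing] factors
   through [tr (X^2)] and [det X]. *)
Require Import Defs.
From mathcomp Require Import all_boot all_order all_algebra.
From mathcomp Require Import complex zify ring lra.
From mathcomp Require Import all_classical all_reals all_analysis.
From mathcomp Require Import measurable_realfun.

Import GRing.Theory Num.Theory.
Local Open Scope complex_scope.
Local Open Scope ring_scope.

Section local_integrability.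
Set Implicit Arguments.
Unset Strict Implicit.
Import Order.TTheory numFieldNormedType.Exports.
Local Open Scope classical_set_scope.
Context {R : realType}.

(** * Integrability of the inverse square root *)

(* The integral of a nonnegative function is a supremum over the simple
   functions below it, hence is monotone even for nonmeasurable functions. *)
Lemma ge0_le_integral_subset d (T : measurableType d)
    (mu : {measure set T -> \bar R}) (D1 D2 : set T) (f1 f2 : T -> \bar R) :
  D1 `<=` D2 -> (forall x, D1 x -> (0 <= f1 x)%E) ->
  (forall x, D2 x -> (0 <= f2 x)%E) ->
  (forall x, D1 x -> (f1 x <= f2 x)%E) ->
  (\int[mu]_(x in D1) f1 x <= \int[mu]_(x in D2) f2 x)%E.
Proof.
move=> D12 f10 f20 f12; rewrite !ge0_integralE//.
apply: le_ereal_sup => _ [h hf1 <-]; exists h => // x.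
apply: (le_trans (hf1 x)); rewrite !patchE.
case: ifPn => [xD1|_].
  rewrite mem_set; last by apply: D12; rewrite inE in xD1.
  by apply: f12; rewrite inE in xD1.
by case: ifPn => // xD2; apply: f20; rewrite inE in xD2.
Qed.

(** Since [powR] sends 0 to 0 at the nonzero exponent -1/2, [isqrt 0 = 0], and multiplicativity
    holds without exception. *)
Definition isqrt (x : R) : R := `|x| `^ (- 2^-1).

Lemma isqrtE x : isqrt x = (Num.sqrt `|x|)^-1.
Proof. by rewrite /isqrt powRN powR12_sqrt. Qed.

Lemma isqrt_ge0 x : 0 <= isqrt x.
Proof. exact: powR_ge0. Qed.

Lemma isqrt0 : isqrt 0 = 0.
Proof. by rewrite isqrtE normr0 sqrtr0 invr0. Qed.

Lemma isqrtM x y : isqrt (x * y) = isqrt x * isqrt y.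
Proof. by rewrite /isqrt normrM powRM. Qed.

Lemma measurable_isqrt : measurable_fun setT isqrt.
Proof.
exact: (measurableT_comp (measurable_powR _) (normr_measurable (D := setT))).
Qed.

Definition dyadic (k : nat) (x : R) : R :=
  2 ^+ k.+1 * \1_[set y : R | `|y| <= 4 ^- k] x.

Lemma dyadic_ge0 k x : 0 <= dyadic k x.
Proof. by rewrite /dyadic mulr_ge0// exprn_ge0. Qed.

(** If [4^-(k+1) < |x| <= 4^-k], then [|x|^(-1/2) <= 2^(k+1)], so a single term of the series
    already dominates. The summand 1 takes care of [|x| > 1]. *)
Lemma isqrt_le_dyadic (x : R) :
  ((isqrt x)%:E <= 1 + \sum_(0 <= k <oo) (dyadic k x)%:E)%E.
Proof.
have t0 k : (0 <= (dyadic k x)%:E)%E by rewrite lee_fin dyadic_ge0.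
have s0 : (0 <= \sum_(0 <= k <oo) (dyadic k x)%:E)%E.
  by apply: nneseries_ge0 => k _ _; exact: t0.
have [x0|x0] := eqVneq x 0; first by rewrite {1}x0 isqrt0 adde_ge0.
have [x1|x1] := ltP 1 `|x|.
  apply: (@le_trans _ _ 1%E); last by rewrite leeDl.
  rewrite lee_fin isqrtE invf_le1 ?sqrtr_gt0 ?normr_gt0//.
  by rewrite -[leLHS]sqrtr1 ler_sqrt// ltW.
have [k [k1 k2]] : exists k, 4 ^- k.+1 < `|x| /\ `|x| <= 4 ^- k.
  have ex : exists n, 4 ^- n < `|x|.
    have xp : 0 < `|x|^-1 by rewrite invr_gt0 normr_gt0.
    exists (Num.truncn `|x|^-1).+1.
    rewrite invf_plt ?posrE ?exprn_gt0 ?normr_gt0//.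
    apply: (lt_le_trans (truncnS_gt _)).
    by rewrite -natrX ler_nat ltnW// ltn_expl.
  (* The least [n] with [4^-n < |x|] is not 0 because [|x| <= 1]; its predecessor is the required
     [k]. *)
  case: (ex_minnP ex) => -[|k] k1 kmin.
    by move: k1; rewrite expr0 invr1 ltNge x1.
  by exists k; split => //; rewrite leNgt; apply/negP => /kmin; rewrite ltnn.
apply: (@le_trans _ _ (dyadic k x)%:E).
  rewrite /dyadic indicE mem_set//= mulr1 lee_fin isqrtE.
  rewrite invf_ple ?posrE ?sqrtr_gt0 ?normr_gt0 ?exprn_gt0//.
  rewrite -[leLHS]ger0_norm ?invr_ge0 ?exprn_ge0// -sqrtr_sqr ler_sqrt//.
  rewrite -exprVn -exprM mulnC exprM exprVn -natrX (_ : (2 ^ 2)%N = 4%N)//.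
  by rewrite exprVn ltW.
apply: (@le_trans _ _ (\sum_(0 <= k <oo) (dyadic k x)%:E)%E).
  apply: le_trans (nneseries_lim_ge k.+1 _) => //.
  by rewrite big_nat_recr//= leeDr// sume_ge0.
by rewrite leeDr.
Qed.

(** The dyadic term of index [k] has integral at most [2^(k+1) * (2 * 4^-k) = 8 / 2^(k+1)], and
    these bounds sum to 8. Only the lengths of intervals enter, so the estimate is uniform in the
    centre [e]. *)
Lemma integral_isqrt_le (a b e : R) : a <= b ->
  (\int[lebesgue_measure]_(t in `[a, b]) (isqrt (t - e))%:E
   <= (b - a + 8)%:E)%E.
Proof.
move=> ab.
pose f k (t : R) : \bar R := (dyadic k (t - e))%:E.
have f0 k t : (0 <= f k t)%E by rewrite lee_fin dyadic_ge0.
have fE k t : f k t =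
    ((2 ^+ k.+1)%:E * (\1_[set t : R | (`|t - e| <= 4 ^- k)%R] t)%:E)%E by [].
have AE k : [set t : R | `|t - e| <= 4 ^- k] = `[e - 4 ^- k, e + 4 ^- k].
  by apply/seteqP; split => t /=; rewrite in_itv/= distrC ler_distlC.
have mA k : measurable [set t : R | `|t - e| <= 4 ^- k].
  by rewrite AE; exact: measurable_itv.
have mf k : measurable_fun `[a, b] (f k).
  apply/measurable_EFinP/(measurable_funM (measurable_cst _)).
  exact: (measurable_indic (mA k)).
apply: (@le_trans _ _ (\int[lebesgue_measure]_(t in `[a, b])
    (1 + \sum_(0 <= k <oo) f k t))%E).
  apply: ge0_le_integral_subset => // t _.
  - by rewrite lee_fin isqrt_ge0.
  - by rewrite adde_ge0// nneseries_ge0.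
  - exact: isqrt_le_dyadic.
rewrite ge0_integralD//=; last 2 first.
- by move=> t _; rewrite nneseries_ge0.
- exact: (@ge0_emeasurable_sum _ _ _ _ f xpredT).
rewrite EFinD leeD//.
  rewrite integral_cst// mul1e /= lebesgue_measure_itv/= lte_fin.
  by case: ifPn => // _; rewrite lee_fin subr_ge0.
rewrite integral_nneseries//.
apply: le_trans (epsilon_trick0 xpredT (_ : 0 <= 8)) => //.
apply: lee_nneseries => k _; first by move=> _; apply: integral_ge0.
under eq_integral do rewrite fE.
rewrite ge0_integralZl_EFin//; last first.
  by apply/measurable_EFinP; exact: (measurable_indic (mA k)).
rewrite integral_indic//; last exact: mA.
apply: (@le_trans _ _ ((2 ^+ k.+1)%:E * (2 * 4 ^- k)%:E)%E).
  rewrite lee_wpmul2l ?lee_fin ?exprn_ge0//.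
  apply: (@le_trans _ _ (lebesgue_measure [set t : R | `|t - e| <= 4 ^- k])).
    apply: le_measure; last exact: subIsetl.
      by apply/mem_set; apply: measurableI => //; exact: mA.
    by apply/mem_set; exact: mA.
  rewrite AE lebesgue_measure_itv/= lte_fin.
  case: ifPn => _; last by rewrite lee_fin mulr_ge0// invr_ge0 exprn_ge0.
  by rewrite -EFinB lee_fin; lra.
rewrite -EFinM lee_fin natrX.
have -> : (4 : R) = 2 * 2 by rewrite -natrM.
have p0 : (2 : R) ^+ k != 0 by rewrite expf_neq0.
rewrite le_eqVlt; apply/orP; left; apply/eqP.
by rewrite exprMn !exprS; field.
Qed.

(** * Complex series *)

Implicit Types z w : R[i].

Lemma ReD z w : complex.Re (z + w) = complex.Re z + complex.Re w.
Proof. by case: z w => [? ?] [? ?]. Qed.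

Lemma ImD z w : complex.Im (z + w) = complex.Im z + complex.Im w.
Proof. by case: z w => [? ?] [? ?]. Qed.

Lemma ReN z : complex.Re (- z) = - complex.Re z.
Proof. by case: z. Qed.

Lemma ImN z : complex.Im (- z) = - complex.Im z.
Proof. by case: z. Qed.

Lemma ReM z w :
  complex.Re (z * w) = complex.Re z * complex.Re w - complex.Im z * complex.Im w.
Proof. by case: z w => [? ?] [? ?]. Qed.

Lemma ImM z w :
  complex.Im (z * w) = complex.Re z * complex.Im w + complex.Im z * complex.Re w.
Proof. by case: z w => [? ?] [? ?]. Qed.

Lemma cabsE z : cabs z = Num.sqrt (complex.Re z ^+ 2 + complex.Im z ^+ 2).
Proof. by rewrite /cabs normc_def. Qed.

Lemma cabsC z : (cabs z)%:C = `|z|.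
Proof. by rewrite cabsE normc_def. Qed.

Lemma cabs_ge0 z : 0 <= cabs z.
Proof. by rewrite cabsE sqrtr_ge0. Qed.

Lemma cabsM z w : cabs (z * w) = cabs z * cabs w.
Proof.
by apply: complexI; rewrite rmorphM/= !cabsC normrM.
Qed.

Lemma cabs0 : cabs (0 : R[i]) = 0.
Proof. by rewrite /cabs normr0. Qed.

Lemma cabs1 : cabs (1 : R[i]) = 1.
Proof. by rewrite /cabs normr1. Qed.

Lemma cabsX z n : cabs (z ^+ n) = cabs z ^+ n.
Proof. by elim: n => [|n ih]; rewrite ?expr0 ?cabs1// !exprS cabsM ih. Qed.

Lemma cabsV z : cabs z^-1 = (cabs z)^-1.
Proof. by apply: complexI; rewrite fmorphV/= !cabsC normfV. Qed.

Lemma cabsD z w : cabs (z + w) <= cabs z + cabs w.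
Proof. by rewrite -lecR rmorphD/= !cabsC ler_normD. Qed.

Lemma cabsN z : cabs (- z) = cabs z.
Proof. by apply: complexI; rewrite !cabsC normrN. Qed.

Lemma cabsB z w : cabs (z - w) <= cabs z + cabs w.
Proof. by rewrite -(cabsN w) cabsD. Qed.

Lemma cabs_real (x : R) : cabs x%:C = `|x|.
Proof. by rewrite cabsE/= expr0n addr0 sqrtr_sqr. Qed.

Lemma cabs_nat n : cabs (n%:R : R[i]) = n%:R.
Proof. by rewrite -(rmorph_nat (real_complex R)) cabs_real ger0_norm. Qed.

Lemma cabs_eq0 z : (cabs z == 0) = (z == 0).
Proof. by rewrite -(inj_eq (@complexI R)) cabsC normr_eq0. Qed.

Lemma cabs_ge_Re z : `|complex.Re z| <= cabs z.
Proof. by rewrite -lecR cabsC normc_ge_Re. Qed.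

Lemma cabs_ge_Im z : `|complex.Im z| <= cabs z.
Proof. by rewrite cabsE -sqrtr_sqr ler_sqrt ?lerDr// ?addr_ge0 ?sqr_ge0. Qed.

Lemma cabs_le_ReIm z : cabs z <= `|complex.Re z| + `|complex.Im z|.
Proof.
rewrite -[leRHS]ger0_norm ?addr_ge0// -sqrtr_sqr cabsE ler_sqrt ?sqr_ge0//.
rewrite sqrrD !real_normK ?num_real// lerD2r lerDl.
by rewrite mulrn_wge0 ?mulr_ge0.
Qed.

Lemma cvg_complex (u : nat -> R[i]) (a b : R) :
  (fun n => complex.Re (u n)) @ \oo --> a ->
  (fun n => complex.Im (u n)) @ \oo --> b ->
  (u : nat -> R[i]^o) @ \oo --> (a +i* b : R[i]^o).
Proof.
move=> ua ub; apply/cvgrPdist_le => /= e e0.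
(* Positive elements of [R[i]] are real, so the radius [e] is a positive real number. *)
have [e1 e2] : complex.Im e = 0 /\ 0 < complex.Re e.
  by move: e0; rewrite ltcE/= => /andP[/eqP].
have -> : e = (complex.Re e)%:C by case: e e0 e1 {e2} => ? ? /= _ ->.
have e3 : 0 < complex.Re e / 2 by rewrite divr_gt0.
near=> n.
rewrite -cabsC lecR (le_trans (cabs_le_ReIm _))// [leRHS](splitr).
rewrite ReD ReN ImD ImN/= lerD//; near: n.
  by move/cvgrPdist_le: ua; apply.
by move/cvgrPdist_le: ub; apply.
Unshelve. all: end_near. Qed.

Lemma Re_series (c : nat -> R[i]) :
  (fun n => complex.Re (series c n)) = series (fun n => complex.Re (c n)).
Proof. by apply/funext => n; rewrite /series/= (big_morph _ ReD (erefl _)). Qed.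

Lemma Im_series (c : nat -> R[i]) :
  (fun n => complex.Im (series c n)) = series (fun n => complex.Im (c n)).
Proof. by apply/funext => n; rewrite /series/= (big_morph _ ImD (erefl _)). Qed.

Lemma is_cvg_series_dom (a b : nat -> R) : (forall n, `|a n| <= b n) ->
  cvgn (series b) -> cvgn (series a).
Proof.
move=> ab cb; apply: normed_cvg; apply: series_le_cvg cb => //= n.
exact: le_trans (normr_ge0 _) (ab n).
Qed.

Lemma norm_series_dom (a b : nat -> R) : (forall n, `|a n| <= b n) ->
  cvgn (series b) -> `|limn (series a)| <= limn (series b).
Proof.
move=> ab cb.
have cn : cvgn [normed series a].
  apply: series_le_cvg cb => //= n.
  exact: le_trans (normr_ge0 _) (ab n).
by apply: (le_trans (lim_series_norm cn)); exact: lim_series_le.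
Qed.

(** The majorant makes the real and imaginary series converge, so the limit in [csum] is a genuine
    one and can be computed componentwise. *)
Lemma csumE (c : nat -> R[i]) (b : nat -> R) : (forall n, cabs (c n) <= b n) ->
  cvgn (series b) ->
  csum c = limn (series (fun n => complex.Re (c n)))
           +i* limn (series (fun n => complex.Im (c n))).
Proof.
move=> cb vb; apply: (@cvg_lim _ (@norm_hausdorff _ R[i]^o)).
apply: cvg_complex.
  rewrite Re_series.
  apply: (is_cvg_series_dom _ vb) => n.
  exact: le_trans (cabs_ge_Re _) (cb n).
rewrite Im_series.
apply: (is_cvg_series_dom _ vb) => n.
exact: le_trans (cabs_ge_Im _) (cb n).
Qed.

Lemma cabs_csum_le (c : nat -> R[i]) (b : nat -> R) :
  (forall n, cabs (c n) <= b n) -> cvgn (series b) ->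
  cabs (csum c) <= 2 * limn (series b).
Proof.
move=> cb vb; rewrite (csumE cb vb) (le_trans (cabs_le_ReIm _))//=.
rewrite mulr_natl mulr2n lerD// norm_series_dom// => n.
  exact: le_trans (cabs_ge_Re _) (cb n).
exact: le_trans (cabs_ge_Im _) (cb n).
Qed.

Lemma csumB (c d : nat -> R[i]) (b b' : nat -> R) :
  (forall n, cabs (c n) <= b n) -> cvgn (series b) ->
  (forall n, cabs (d n) <= b' n) -> cvgn (series b') ->
  csum c - csum d = csum (fun n => c n - d n).
Proof.
move=> cb vb db vb'; rewrite (csumE cb vb) (csumE db vb').
rewrite (@csumE _ (b \+ b')); first last.
- by rewrite seriesD; exact: is_cvgD.
- move=> n /=; rewrite (le_trans (cabsB _ _))// lerD//.
apply/eqP; rewrite eq_complex/=; apply/andP; split; apply/eqP.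
  rewrite -limB; first last.
  - apply: (is_cvg_series_dom _ vb') => n.
    exact: le_trans (cabs_ge_Re _) (db n).
  - apply: (is_cvg_series_dom _ vb) => n.
    exact: le_trans (cabs_ge_Re _) (cb n).
  rewrite -seriesN -seriesD; congr (limn (series _)).
  by apply/funext => n /=; rewrite ReD ReN.
rewrite -limB; first last.
- apply: (is_cvg_series_dom _ vb') => n.
  exact: le_trans (cabs_ge_Im _) (db n).
- apply: (is_cvg_series_dom _ vb) => n.
  exact: le_trans (cabs_ge_Im _) (cb n).
rewrite -seriesN -seriesD; congr (limn (series _)).
by apply/funext => n /=; rewrite ImD ImN.
Qed.

(** Common shape of the two series: [c = 1] gives [Phi], and [c n = acoef n] gives [wser] by mere
    unfolding. *)
Definition psum (c : nat -> R) (lambda z : R[i]) : R[i] :=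
  csum (fun n => (c n)%:C * (lambda * z) ^+ n / (4 ^+ n * (n`!%:R) ^+ 2)).

Lemma Phi_psum (lambda z : R[i]) : Phi lambda z = psum (fun=> 1) lambda z.
Proof.
by rewrite /Phi /psum; congr (csum _); apply/funext => n; rewrite mul1r.
Qed.

Definition fact_growth (c : nat -> R) (C : R) :=
  forall n, `|c n| <= C * 2 ^+ n * (n.+1)`!%:R.

Lemma fact_growth_ge0 c C : fact_growth c C -> 0 <= C.
Proof.
move=> /(_ 0); rewrite expr0 factS fact0 !mulr1.
exact: le_trans.
Qed.

(** Dividing [2^n * (n+1)!] by [4^n * n!^2] leaves [(n+1) / 2^n <= 1] times [1 / n!], so the terms
    are dominated by an exponential series. The factor [x] is kept apart from [lambda ^+ n] so that
    it can stand for a power [z ^+ n] or for a difference of two powers. *)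
Lemma cabs_psum_term c C (lambda x : R[i]) (y : R) n :
  fact_growth c C -> cabs x <= y ->
  cabs ((c n)%:C * (lambda ^+ n * x) / (4 ^+ n * (n`!%:R) ^+ 2))
  <= C * (cabs lambda ^+ n * y / n`!%:R).
Proof.
move=> cC xy; have C0 := fact_growth_ge0 cC.
have n0 : (0 : R) < n`!%:R by rewrite ltr0n fact_gt0.
rewrite !cabsM cabs_real cabsV cabsM !cabsX !cabs_nat.
apply: (@le_trans _ _ (C * 2 ^+ n * (n.+1)`!%:R *
    (cabs lambda ^+ n * y) / (4 ^+ n * n`!%:R ^+ 2))).
  rewrite ler_wpM2r ?invr_ge0 ?mulr_ge0 ?exprn_ge0//.
  by rewrite ler_pM ?mulr_ge0 ?exprn_ge0 ?cabs_ge0 ?cC ?ler_wpM2l ?exprn_ge0 ?cabs_ge0.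
have y0 : 0 <= y by rewrite (le_trans (cabs_ge0 x)).
have -> : C * 2 ^+ n * (n.+1)`!%:R * (cabs lambda ^+ n * y) /
    (4 ^+ n * n`!%:R ^+ 2) =
    C * (cabs lambda ^+ n * y / n`!%:R) * (n.+1%:R / 2 ^+ n).
  have -> : (4 : R) = 2 * 2 by rewrite -natrM.
  rewrite factS natrM exprMn.
  field; apply/andP; split; first by rewrite expf_neq0.
  by rewrite gt_eqF.
rewrite -[leRHS]mulr1 ler_wpM2l//.
  by rewrite mulr_ge0// divr_ge0// ?mulr_ge0// exprn_ge0// cabs_ge0.
by rewrite ler_pdivrMr ?exprn_gt0// mul1r -natrX ler_nat ltn_expl.
Qed.

(** Factoring out [z - w] leaves [n] products of modulus at most [M^(n-1) <= M^n], and [n <= 2^n].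
    The bound is geometric in [n], hence again summable against the exponential coefficients. *)
Lemma cabs_subX (z w : R[i]) (M : R) n : 1 <= M -> cabs z <= M -> cabs w <= M ->
  cabs (z ^+ n - w ^+ n) <= cabs (z - w) * (2 * M) ^+ n.
Proof.
move=> M1 zM wM; have M0 : 0 <= M by rewrite (le_trans _ M1).
rewrite subrXX cabsM ler_wpM2l ?cabs_ge0//.
have cabs_sum m (F : 'I_m -> R[i]) :
    cabs (\sum_i F i) <= \sum_i cabs (F i).
  elim/big_ind2 : _ => //; first by rewrite cabs0.
  by move=> x1 x2 y1 y2 h1 h2; rewrite (le_trans (cabsD _ _))// lerD.
apply: (le_trans (cabs_sum _ _)).
apply: (@le_trans _ _ (\sum_(i < n) M ^+ n)).
  apply: ler_sum => i _; rewrite cabsM !cabsX.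
  apply: (@le_trans _ _ (M ^+ (n.-1 - i) * M ^+ i)).
    by rewrite ler_pM ?exprn_ge0 ?cabs_ge0 ?lerXn2r ?nnegrE ?cabs_ge0.
  by rewrite -exprD ler_weXn2l//; case: i => i /=; lia.
rewrite sumr_const card_ord -[leLHS]mulr_natl exprMn ler_wpM2r ?exprn_ge0//.
by rewrite -natrX ler_nat ltnW// ltn_expl.
Qed.

Definition bounded_lip (f : R[i] -> R[i]) (M B : R) :=
  forall z w, cabs z <= M -> cabs w <= M ->
    cabs (f z) <= B /\ cabs (f z - f w) <= B * cabs (z - w).

Lemma is_cvg_expM (C x : R) : cvgn (series (fun n => C * (exp_coeff x n))).
Proof.
have -> : (fun n => C * exp_coeff x n) = C *: exp_coeff x by [].
rewrite seriesZ; apply: is_cvgZr; exact: is_cvg_series_exp_coeff.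
Qed.

(** The values are bounded through the exponential series at [|lambda| * M]. The differences are
    bounded by subtracting term by term, which leads to the exponential series at
    [2 * |lambda| * M]. *)
Lemma psum_bounded_lip c C lambda M : fact_growth c C -> 1 <= M ->
  exists2 B, 0 <= B & bounded_lip (psum c lambda) M B.
Proof.
move=> cC M1; set L := cabs lambda.
have bnd z : cabs z <= M -> forall n,
    cabs ((c n)%:C * (lambda * z) ^+ n / (4 ^+ n * (n`!%:R) ^+ 2))
    <= C * exp_coeff (L * M) n.
  move=> zM n; rewrite exprMn.
  apply: le_trans (cabs_psum_term _ _ cC _) _; last first.
    by rewrite /exp_coeff/= exprMn.
  by rewrite cabsX lerXn2r ?nnegrE ?cabs_ge0// (le_trans _ M1).
set B1 := 2 * limn (series (fun n => C * exp_coeff (L * M) n)).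
set B2 := 2 * limn (series (fun n => C * exp_coeff (L * (2 * M)) n)).
exists (Num.max (Num.max B1 B2) 0); first by rewrite le_max lexx orbT.
move=> z w zM wM; split.
  apply: (@le_trans _ _ B1); last by rewrite !le_max lexx.
  exact: cabs_csum_le (bnd _ zM) (@is_cvg_expM _ _).
apply: (@le_trans _ _ (B2 * cabs (z - w))); last first.
  by rewrite ler_wpM2r ?cabs_ge0// !le_max lexx orbT.
rewrite (csumB (bnd _ zM) (@is_cvg_expM _ _) (bnd _ wM) (@is_cvg_expM _ _)).
have cv : cvgn (series (fun n => cabs (z - w) * (C * exp_coeff (L * (2 * M)) n))).
  by under eq_fun do rewrite mulrA; exact: is_cvg_expM.
apply: le_trans (cabs_csum_le _ cv) _; last first.
  have -> : (fun n => cabs (z - w) * (C * exp_coeff (L * (2 * M)) n)) =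
    cabs (z - w) *: (fun n => (C * exp_coeff (L * (2 * M)) n)) by [].
  rewrite seriesZ limZr; last exact: is_cvg_expM.
  by rewrite /B2 -[_ *: _]/(_ * _) mulrCA mulrC.
move=> n; rewrite -mulrBl -mulrBr !exprMn -mulrBr.
apply: le_trans (cabs_psum_term _ _ cC (cabs_subX n M1 zM wM)) _.
rewrite /exp_coeff/= exprMn -/L.
rewrite le_eqVlt; apply/orP; left; apply/eqP.
by rewrite !exprMn; ring.
Qed.

(** Adding and subtracting [f u * g u] writes the bracket as two products, each with a factor
    [f u - f v] or [g u - g v]; the Lipschitz bound on that factor cancels the denominator. *)
Lemma bounded_lip_bracket f g M B u v :
  bounded_lip f M B -> bounded_lip g M B -> u != v ->
  cabs u <= M -> cabs v <= M ->
  cabs (bracket f g u v / (u - v)) <= 2 * B ^+ 2.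
Proof.
move=> fB gB uv uM vM; rewrite cabsM cabsV.
rewrite ler_pdivrMr; last first.
  by rewrite lt_neqAle cabs_ge0 eq_sym cabs_eq0 subr_eq0 uv.
have -> : bracket f g u v = (f u - f v) * g u - f u * (g u - g v).
  by rewrite /bracket; ring.
rewrite (le_trans (cabsB _ _))// !cabsM.
have [fu fuv] := fB _ _ uM vM.
have [gu guv] := gB _ _ uM vM.
have -> : 2 * B ^+ 2 * cabs (u - v) =
  B * cabs (u - v) * B + B * (B * cabs (u - v)) by ring.
by rewrite lerD// ler_pM ?cabs_ge0.
Qed.

(** * Growth of the coefficients of the second solution *)

Lemma expR_ge1 (x : R) : (1 <= expR x) = (0 <= x).
Proof. by rewrite -expR0 ler_expR. Qed.

(** Both signs reduce to [1 + x <= expR x], taken at [- y] when [y] is nonnegative and at [y]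
    otherwise. *)
Lemma norm_expR_sub1 (y : R) : `|expR y - 1| <= `|y| * expR `|y|.
Proof.
have [y0|y0] := leP 0 y.
  rewrite !ger0_norm//; last by rewrite subr_ge0 expR_ge1.
  have := expR_ge1Dx (- y); rewrite expRN => h.
  have e0 := expR_gt0 y.
  have : (1 - y) * expR y <= 1.
    by rewrite -ler_pdivlMr// div1r.
  by nra.
have h := expR_ge1Dx y.
have e1 : expR y < 1 by rewrite expR_lt1.
rewrite ltr0_norm ?subr_lt0// (ltr0_norm y0).
have : 1 <= expR (- y) by rewrite expR_ge1 oppr_ge0 ltW.
by nra.
Qed.

Lemma powR_expR (t x : R) : 0 < t -> t `^ x = expR (x * ln t).
Proof. by move=> t0; rewrite /powR gt_eqF. Qed.

Lemma expR_half_le (L : R) : expR (`|L| / 2) <= expR (L / 2) + expR (- (L / 2)).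
Proof.
have [L0|L0] := leP 0 L; first by rewrite ger0_norm// lerDl expR_ge0.
by rewrite ltr0_norm// mulNr lerDr expR_ge0.
Qed.

(** The sum is [2 * cosh (ln t / 2)]; it dominates [expR (|ln t| / 2)], which treats small and large
    [t] at once. *)
Lemma sqrt_isqrt_expR (t : R) : 0 < t ->
  Num.sqrt t + isqrt t = expR (ln t / 2) + expR (- (ln t / 2)).
Proof.
move=> t0; rewrite isqrtE (gtr0_norm t0) -powR12_sqrt ?ltW// powR_expR//.
by rewrite expRN mulrC.
Qed.

Lemma powR_le_sqrt (t h : R) : 0 < t -> `|h| <= 4^-1 ->
  t `^ h <= Num.sqrt t + isqrt t.
Proof.
move=> t0 h4; rewrite sqrt_isqrt_expR// powR_expR//.
apply: le_trans (expR_half_le _); rewrite ler_expR.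
apply: (le_trans (ler_norm _)); rewrite normrM mulrC ler_wpM2l//.
by lra.
Qed.

(** With [L = ln t], the left side is at most [|h| * |L| * expR (|h| * |L|)]. As [|h| <= 1/4], the
    exponential costs one factor [expR (|L| / 4)], and [|L| <= 4 * expR (|L| / 4)] costs the
    other. *)
Lemma powR_sub1_le (t h : R) : 0 < t -> `|h| <= 4^-1 ->
  `|t `^ h - 1| <= `|h| * (4 * (Num.sqrt t + isqrt t)).
Proof.
move=> t0 h4; rewrite sqrt_isqrt_expR// powR_expR//.
apply: (le_trans (norm_expR_sub1 _)).
set L := ln t; rewrite normrM -mulrA ler_wpM2l//.
apply: (@le_trans _ _ (4 * expR (`|L| / 2))); last first.
  by rewrite ler_wpM2l// expR_half_le.
have L4 : `|L| <= 4 * expR (`|L| / 4).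
  by have := expR_ge1Dx (`|L| / 4); lra.
have -> : `|L| / 2 = `|L| / 4 + `|L| / 4 by lra.
rewrite expRD mulrA ler_pM ?expR_ge0// ler_expR mulrC ler_wpM2l//.
Qed.

(** The exponential of [t / 2] dominates the term [(t / 2)^n / n!] of its series. Only half of [t]
    is spent, so a product with [expR (- t)] keeps a decaying factor. *)
Lemma exprn_le_expR (t : R) n : 0 <= t ->
  t ^+ n <= 2 ^+ n * n`!%:R * expR (t / 2).
Proof.
move=> t0; have t20 : 0 <= t / 2 by rewrite divr_ge0.
case: n => [|n]; first by rewrite !expr0 fact0 !mul1r expR_ge1.
have := expR_ge1Dxn n t20; set E := expR _; set f : R := n.+1`!%:R => h.
have f0 : 0 < f by rewrite ltr0n fact_gt0.
have : (t / 2) ^+ n.+1 <= f * E.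
  by rewrite [leRHS]mulrC -ler_pdivrMr// (le_trans _ h)// lerDr.
rewrite expr_div_n ler_pdivrMr ?exprn_gt0// => h2.
by rewrite (le_trans h2)// mulrC mulrA.
Qed.

(* Up to a factor depending on [n], this function dominates the integrand of
   Gamma at any point within 1/4 of [n + 1], and the difference quotients of
   that integrand in the parameter. *)
Definition gamma_dom (t : R) : R :=
  2 * exponential_pdf 2^-1 t + (isqrt \_ `[0, 1]) t.

Definition gamma_cst (n : nat) : R := 2 ^+ n.+2 * (n.+1)`!%:R.

Lemma gamma_dom_ge0 t : 0 <= gamma_dom t.
Proof.
rewrite addr_ge0 ?mulr_ge0 ?exponential_pdf_ge0//.
by rewrite patchE; case: ifPn => // _; exact: isqrt_ge0.
Qed.

(** Write [expR (- t)] as the square of [e = expR (- (t / 2))]: one factor absorbs the powers of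
    [t], the other is [2 * exponential_pdf 2^-1 t]. The root satisfies [sqrt t <= 1 + t], and
    [isqrt t] is kept on [[0, 1]] only, being at most 1 beyond. *)
Lemma gamma_domP (t : R) n : 0 < t ->
  t ^+ n * (Num.sqrt t + isqrt t) * expR (- t) <= gamma_cst n * gamma_dom t.
Proof.
move=> t0; set e := expR (- (t / 2)).
have e0 : 0 < e by exact: expR_gt0.
have e1 : e <= 1 by rewrite expR_le1 oppr_le0 divr_ge0// ltW.
have eE : expR (- t) = e * e by rewrite -expRD; congr expR; lra.
have ene : expR (t / 2) * e = 1 by rewrite /e expRN mulfV ?gt_eqF ?expR_gt0.
have tn k : t ^+ k * expR (- t) <= 2 ^+ k * k`!%:R * e.
  rewrite eE mulrA ler_wpM2r ?(ltW e0)//.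
  apply: (@le_trans _ _ (2 ^+ k * k`!%:R * expR (t / 2) * e)).
    by rewrite ler_wpM2r ?(ltW e0)// exprn_le_expR// ltW.
  by rewrite -mulrA ene mulr1.
have -> : gamma_dom t = e + (isqrt \_ `[0, 1]) t.
  rewrite /gamma_dom exponential_pdfE ?ltW// mulrA mulfV// mul1r.
  by congr (expR _ + _); lra.
have A1 : 1 <= gamma_cst n.
  by rewrite mulr_ege1// ?exprn_ege1 ?ler1n ?fact_gt0.
have sq : Num.sqrt t <= 1 + t.
  have := sqr_sqrtr (ltW t0); have := sqrtr_ge0 t.
  by set s := Num.sqrt t; nra.
have isq : t ^+ n * isqrt t <= t ^+ n + (isqrt \_ `[0, 1]) t.
  rewrite patchE; case: ifPn => [|].
    rewrite inE/= in_itv/= => /andP[_ t1].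
    apply: ler_wpDl; first by rewrite exprn_ge0// ltW.
    by rewrite ler_piMl ?isqrt_ge0// exprn_ile1// ltW.
  rewrite notin_setE/= in_itv/= ltW//= => /negP; rewrite -ltNge => t1.
  rewrite addr0 ler_piMr ?exprn_ge0 ?(ltW t0)// isqrtE invf_le1 ?sqrtr_gt0 ?normr_gt0 ?gt_eqF//.
  by rewrite -[leLHS]sqrtr1 ler_sqrt// gtr0_norm// ltW.
have p0 : 0 <= (isqrt \_ `[0, 1]) t.
  by rewrite patchE; case: ifPn => // _; exact: isqrt_ge0.
set p := (isqrt \_ _) t in isq p0 *.
apply: (@le_trans _ _ ((2 * t ^+ n + t ^+ n.+1 + p) * expR (- t))).
  rewrite ler_wpM2r ?expR_ge0// exprS.
  have : 0 <= t ^+ n by rewrite exprn_ge0 ?ltW.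
  by set T := t ^+ n in isq *; nra.
apply: (@le_trans _ _ (2 * (2 ^+ n * n`!%:R * e) + 2 ^+ n.+1 * n.+1`!%:R * e + p)).
  rewrite mulrDl lerD//.
    have := tn n; have := tn n.+1; set E := expR _.
    set T := t ^+ n; set T' := t ^+ n.+1.
    by rewrite mulrDl -mulrA; lra.
  by rewrite ler_piMr// expR_le1 oppr_le0 ltW.
rewrite mulrDr lerD//; last by rewrite ler_peMl.
have h : 2 ^+ n * n`!%:R <= 2 ^+ n * n.+1`!%:R :> R.
  rewrite ler_wpM2l ?exprn_ge0// ler_nat factS leq_pmull//.
rewrite /gamma_cst !exprS.
have := ler_wpM2r (ltW e0) h.
set P : R := 2 ^+ n; set f : R := n`!%:R; set f' : R := n.+1`!%:R => xy.
have -> : 2 * (2 * P) * f' * e = 4 * (P * f' * e) by ring.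
have -> : 2 * P * f' * e = 2 * (P * f' * e) by ring.
by lra.
Qed.

Local Notation mu := (@lebesgue_measure R).
Local Notation Rpos := (`]0, +oo[%classic : set R).

Lemma integrable_gamma_dom : mu.-integrable Rpos (EFin \o gamma_dom).
Proof.
apply: (@integrableS _ _ _ mu setT) => //.
have -> : EFin \o gamma_dom =
    ((fun t => 2%:E * (EFin \o exponential_pdf 2^-1) t) \+
     (EFin \o (isqrt \_ `[0%R, 1%R])))%E by [].
apply: integrableD => //.
  by apply: integrableZl => //; apply: integrable_exponential_pdf.
rewrite -restrict_EFin -integrable_mkcond//.
apply/integrableP; split.
  by apply/measurable_EFinP; apply: measurable_funTS; exact: measurable_isqrt.
apply: (@le_lt_trans _ _ ((1 - 0 + 8)%:E)); last by rewrite ltry.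
apply: le_trans (integral_isqrt_le 0 ler01).
by apply: ge0_le_integral_subset => // t _ /=; rewrite lee_fin ?isqrt_ge0// subr0 ger0_norm// isqrt_ge0.
Qed.

Definition gamma_ker (x t : R) : R := t `^ (x - 1) * expR (- t).

Lemma GammaE (x : R) : Gamma x = \int[mu]_(t in Rpos) gamma_ker x t.
Proof. by []. Qed.

Lemma measurable_gamma_ker (x : R) (D : set R) : measurable_fun D (gamma_ker x).
Proof.
apply: measurable_funTS; apply: measurable_funM.
  exact: (measurable_powR (x - 1)).
by apply: (measurableT_comp (@measurable_expR R)); exact: oppr_measurable.
Qed.

Lemma gamma_ker_near n (h t : R) : 0 < t ->
  gamma_ker (h + (n%:R + 1)) t = t `^ h * (t ^+ n * expR (- t)).
Proof.
move=> t0; rewrite /gamma_ker addrA addrK powRD; last first.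
  by apply/implyP => _; rewrite gt_eqF.
by rewrite powR_mulrn ?ltW// mulrA.
Qed.

Lemma gamma_ker_le n (h t : R) : 0 < t -> `|h| <= 4^-1 ->
  `|gamma_ker (h + (n%:R + 1)) t| <= gamma_cst n * gamma_dom t.
Proof.
move=> t0 h4; apply: le_trans (gamma_domP n t0).
rewrite gamma_ker_near// ger0_norm; last first.
  by rewrite !mulr_ge0 ?powR_ge0 ?exprn_ge0 ?expR_ge0 ?(ltW t0).
rewrite [leRHS]mulrAC mulrC ler_wpM2l ?powR_le_sqrt//.
by rewrite mulr_ge0 ?expR_ge0 ?exprn_ge0 ?(ltW t0).
Qed.

Lemma gamma_ker_diff_le n (h t : R) : 0 < t -> `|h| <= 4^-1 ->
  `|gamma_ker (h + (n%:R + 1)) t - gamma_ker (n%:R + 1) t|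
  <= 4 * `|h| * gamma_cst n * gamma_dom t.
Proof.
move=> t0 h4; rewrite -mulrA.
apply: (@le_trans _ _ (4 * `|h| *
    (t ^+ n * (Num.sqrt t + isqrt t) * expR (- t)))); last first.
  by rewrite ler_wpM2l ?mulr_ge0// gamma_domP.
rewrite -[in X in _ - X](add0r (_ + 1)) !gamma_ker_near// powRr0 -mulrBl.
have te0 : 0 <= t ^+ n * expR (- t).
  by rewrite mulr_ge0 ?expR_ge0 ?exprn_ge0 ?(ltW t0).
rewrite normrM (ger0_norm te0).
have := ler_wpM2r te0 (powR_sub1_le t0 h4).
set x := _ - 1; set s := _ + isqrt t.
suff -> : `|h| * (4 * s) * (t ^+ n * expR (- t)) =
  4 * `|h| * (t ^+ n * s * expR (- t)) by [].
by ring.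
Qed.

Lemma integrable_gamma_cst_dom (c : R) :
  mu.-integrable Rpos (EFin \o (fun t => c * gamma_dom t)).
Proof.
have -> : EFin \o (fun t => c * gamma_dom t) =
  (fun t => c%:E * (EFin \o gamma_dom) t)%E by [].
by apply: integrableZl => //; exact: integrable_gamma_dom.
Qed.

Lemma integrable_gamma_ker n (h : R) : `|h| <= 4^-1 ->
  mu.-integrable Rpos (EFin \o gamma_ker (h + (n%:R + 1))).
Proof.
move=> h4; apply: le_integrable (integrable_gamma_cst_dom (gamma_cst n)) => //.
  by apply/measurable_EFinP; exact: measurable_gamma_ker.
move=> t /=; rewrite in_itv/= andbT => t0.
rewrite lee_fin (le_trans (gamma_ker_le n t0 h4))//.
by rewrite ler_norm.
Qed.

(** Integrating the pointwise estimate on the kernel gives a Lipschitz bound at [n + 1], hence a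
    bound on the difference quotients of [Gamma] there. *)
Lemma Gamma_diff_le n (h : R) : `|h| <= 4^-1 ->
  `|Gamma (h + (n%:R + 1)) - Gamma (n%:R + 1)|
  <= `|h| * (4 * gamma_cst n * \int[mu]_(t in Rpos) gamma_dom t).
Proof.
move=> h4.
have i0 : mu.-integrable Rpos (EFin \o gamma_ker (n%:R + 1)).
  by rewrite -(add0r (_ + 1)); apply: integrable_gamma_ker; rewrite normr0.
have ih := integrable_gamma_ker n h4.
have id : mu.-integrable Rpos
    (EFin \o (fun t => gamma_ker (h + (n%:R + 1)) t - gamma_ker (n%:R + 1) t)).
  have -> : EFin \o (fun t => gamma_ker (h + (n%:R + 1)) t - gamma_ker (n%:R + 1) t)
    = ((EFin \o gamma_ker (h + (n%:R + 1))) \- (EFin \o gamma_ker (n%:R + 1)))%E.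
    by [].
  by apply: integrableB.
rewrite !GammaE -RintegralB//.
apply: (le_trans (le_normr_Rintegral _ id)) => //.
apply: (@le_trans _ _ (\int[mu]_(t in Rpos)
    (4 * `|h| * gamma_cst n * gamma_dom t))).
  apply: le_Rintegral => //.
  - exact: (integrable_abse id).
  - exact: integrable_gamma_cst_dom.
  - by move=> t /=; rewrite in_itv/= andbT => t0; exact: gamma_ker_diff_le.
rewrite RintegralZl//; last exact: integrable_gamma_dom.
by rewrite le_eqVlt; apply/orP; left; apply/eqP; ring.
Qed.

(** On [[1, 2]] the integrand [t^n * expR (- t)] is at least [expR (- 2)]. The bound controls the
    denominator of [acoef]. *)
Lemma Gamma_ge n : expR (- 2) <= Gamma (n%:R + 1 : R).
Proof.
have i0 : mu.-integrable Rpos (EFin \o gamma_ker (n%:R + 1)).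
  by rewrite -(add0r (_ + 1)); apply: integrable_gamma_ker; rewrite normr0.
rewrite GammaE /Rintegral -lee_fin fineK; last first.
  exact: integrable_fin_num i0.
have k0 t : 0 <= gamma_ker (n%:R + 1) t.
  by rewrite mulr_ge0 ?powR_ge0 ?expR_ge0.
apply: (@le_trans _ _ (\int[mu]_(t in `[1%R, 2%R]) (cst (expR (- 2))%:E) t)%E).
  rewrite integral_cst//= lebesgue_measure_itv/= lte_fin ltr1n/=.
  by rewrite -EFinB -EFinM lee_fin; lra.
apply: ge0_le_integral_subset.
- move=> t /=; rewrite !in_itv/= => /andP[t1 _]; rewrite andbT.
  exact: lt_le_trans t1.
- by move=> t _; rewrite lee_fin expR_ge0.
- by move=> t _; rewrite lee_fin.
move=> t /=; rewrite in_itv/= => /andP[t1 t2].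
have t0 : 0 < t by exact: lt_le_trans t1.
rewrite -(add0r (_ + 1)) lee_fin gamma_ker_near// powRr0 mul1r.
apply: (@le_trans _ _ (1 * expR (- t))).
  by rewrite mul1r ler_expR lerN2.
by rewrite ler_wpM2r ?expR_ge0// exprn_ege1.
Qed.

(* If the limit defining [derive1 f a] does not exist, its junk value is [0]. *)
Lemma norm_derive1_le (f : R -> R) (a B e : R) : 0 < e -> 0 <= B ->
  (forall h, `|h| <= e -> `|f (h + a) - f a| <= `|h| * B) ->
  `|derive1 f a| <= B.
Proof.
move=> e0 B0 fB; rewrite /derive1.
set q := (X in lim X).
have [cq|/dvgP ->] := pselect (cvg q); last by rewrite normr0.
rewrite -lim_norm//; apply: limr_le; first exact: is_cvg_norm.
near=> h.
have h0 : h != 0 by near: h; exact: nbhs_dnbhs_neq.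
have he : `|h| <= e.
  near: h; apply: dnbhs0_le => //.
rewrite normrZ normfV ler_pdivrMl ?normr_gt0//.
exact: fB.
Unshelve. all: by end_near. Qed.

Lemma acoef_fact_growth : exists C, fact_growth (fun n => acoef n%:R) C.
Proof.
pose I := \int[mu]_(t in Rpos) gamma_dom t.
have I0 : 0 <= I.
  by apply: Rintegral_ge0 => t _; exact: gamma_dom_ge0.
(* The factor 32 collects 2 from [acoef], 4 from the Lipschitz bound and [2^2] from [gamma_cst];
   [expR 2] bounds the inverse of [Gamma]. *)
exists (32 * I * expR 2) => n.
have c0 : 0 <= gamma_cst n by rewrite mulr_ge0 ?exprn_ge0.
have B0 : 0 <= 4 * gamma_cst n * I by rewrite mulr_ge0// mulr_ge0.
have p4 : 0 < 4^-1 :> R by rewrite invr_gt0.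
have d := norm_derive1_le p4 B0 (@Gamma_diff_le n).
have g := Gamma_ge n.
have g0 : 0 < Gamma (n%:R + 1 : R) by exact: lt_le_trans (expR_gt0 _) g.
rewrite /acoef normrM normrN normr_nat normrM normfV (gtr0_norm g0).
have gi : (Gamma (n%:R + 1 : R))^-1 <= expR 2.
  by rewrite invf_ple ?posrE ?expR_gt0// -expRN.
apply: (@le_trans _ _ (2 * (4 * gamma_cst n * I * expR 2))).
  rewrite ler_wpM2l// ler_pM// ?invr_ge0 ?(ltW g0)//.
rewrite /gamma_cst !exprS le_eqVlt; apply/orP; left; apply/eqP.
by ring.
Qed.

(** * The invariants Q and S *)

Lemma det_mx2 (K : comNzRingType) (A : 'M[K]_2) :
  \det A = A 0 0 * A 1 1 - A 0 1 * A 1 0.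
Proof.
rewrite (expand_det_row A 0) !big_ord_recl big_ord0 addr0 /cofactor !det_mx11.
rewrite !mxE /= !(addn0, expr0, mul1r) /bump/= expr1 mulN1r mulrN.
by congr (_ * A _ _ - A _ _ * A _ _); apply/val_inj.
Qed.

(** The three unipotent factors multiply to the block matrix with rows [(0, 1)] and [(-1, 0)] and
    have determinant 1. The sign in [- V] disappears because the size 2 is even. *)
Lemma det_block_anti (U V : 'M[R]_2) :
  \det (block_mx 0 U V 0) = \det U * \det V.
Proof.
have e : block_mx 0 U V 0 = block_mx U 0 0 (- V) *m
    (block_mx 1%:M 1%:M 0 1%:M *m block_mx 1%:M 0 (- 1%:M) 1%:M *m
     block_mx 1%:M 1%:M 0 1%:M).
  rewrite !mulmx_block !(mul0mx, mulmx0, mulmx1, mul1mx, addr0, add0r).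
  by rewrite subrr add0r addNr !mulmx0 mulmx1 mulNmx mulmxN mulmx1 opprK.
rewrite e !det_mulmx !det_ublock !det_lblock !det1 !mulr1.
by rewrite -scaleN1r detZ sqrrN expr1n mul1r.
Qed.

Lemma Sinv_block (U V : 'M[R]_2) : Sinv (block_mx 0 U V 0) = \det U * \det V.
Proof. exact: det_block_anti. Qed.

Lemma Qinv_block (U V : 'M[R]_2) : Qinv (block_mx 0 U V 0) = \tr (U *m V).
Proof.
rewrite /Qinv mulmx_block !(mul0mx, mulmx0, addr0, add0r) mxtrace_block.
by rewrite (mxtrace_mulC V U); lra.
Qed.

Definition mdet (m : (R * R) * (R * R)) : R :=
  m.1.1 * m.2.2 - m.1.2 * m.2.1.

Lemma Sinv_qmx (p : qcoord R) : Sinv (qmx p) = mdet p.1 * mdet p.2.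
Proof. by rewrite Sinv_block !det_mx2 !mxE. Qed.

Lemma Qinv_qmx (p : qcoord R) : Qinv (qmx p) =
  p.1.1.1 * p.2.1.1 + p.1.1.2 * p.2.2.1 + p.1.2.1 * p.2.1.2
  + p.1.2.2 * p.2.2.2.
Proof.
rewrite Qinv_block /mxtrace !big_ord_recl big_ord0 !mxE.
by rewrite !big_ord_recl !big_ord0 !mxE /= !addr0 !addrA.
Qed.

(** As [Num.sqrt] vanishes on negative numbers, at most one component is nonzero. This form without
    case distinction makes measurability immediate. *)
Lemma deltaE (X : 'M[R]_(2 + 2)) :
  delta X = Num.sqrt (S0inv X) +i* Num.sqrt (- S0inv X).
Proof.
rewrite /delta; case: ifPn => [S0|]; last rewrite -ltNge => S0.
  by rewrite (@ler0_sqrtr _ (- _)) ?oppr_le0.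
rewrite (ler0_sqrtr (ltW S0)) ltr0_norm//.
by apply/eqP; rewrite eq_complex/= !(mul0r, mulr0, mul1r, sub0r, oppr0, add0r) !eqxx.
Qed.

Lemma delta_sqr (X : 'M[R]_(2 + 2)) : delta X ^+ 2 = (S0inv X)%:C.
Proof.
rewrite deltaE expr2; apply/eqP; rewrite eq_complex/=.
have [S0|/ltW S0] := leP 0 (S0inv X).
  by rewrite (@ler0_sqrtr _ (- _)) ?oppr_le0// !(mul0r, mulr0) -expr2 sqr_sqrtr// subr0 addr0 !eqxx.
rewrite (ler0_sqrtr S0) !(mul0r, mulr0) -expr2 sqr_sqrtr ?oppr_ge0//.
by rewrite sub0r opprK addr0 !eqxx.
Qed.

Lemma uinv_sub_vinv (X : 'M[R]_(2 + 2)) : uinv X - vinv X = delta X.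
Proof. by rewrite /uinv /vinv; field. Qed.

Lemma uinv_mul_vinv (X : 'M[R]_(2 + 2)) : uinv X * vinv X = (Sinv X)%:C.
Proof.
have -> : uinv X * vinv X = ((Qinv X)%:C ^+ 2 - delta X ^+ 2) / 4.
  by rewrite /uinv /vinv; field.
rewrite delta_sqr /S0inv rmorphB/= rmorphXn/= opprB addrC subrK rmorphM/=.
by rewrite mulrC mulrA (rmorph_nat (real_complex R)) mulVf ?mul1r.
Qed.

Lemma cabs_delta_le (X : 'M[R]_(2 + 2)) : cabs (delta X) <= 1 + `|S0inv X|.
Proof.
have : cabs (delta X) ^+ 2 = `|S0inv X|.
  by rewrite -cabsX delta_sqr cabs_real.
by have := cabs_ge0 (delta X); set d := cabs _; nra.
Qed.

Lemma cabs_uinv_le (X : 'M[R]_(2 + 2)) :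
  cabs (uinv X) <= `|Qinv X| + (1 + `|S0inv X|).
Proof.
rewrite /uinv cabsM cabsV cabs_nat ler_pdivrMr//.
rewrite (le_trans (cabsD _ _))// cabs_real.
by have := cabs_delta_le X; have := normr_ge0 (Qinv X);
  have := normr_ge0 (S0inv X); lra.
Qed.

Lemma cabs_vinv_le (X : 'M[R]_(2 + 2)) :
  cabs (vinv X) <= `|Qinv X| + (1 + `|S0inv X|).
Proof.
rewrite /vinv cabsM cabsV cabs_nat ler_pdivrMr//.
rewrite (le_trans (cabsB _ _))// cabs_real.
by have := cabs_delta_le X; have := normr_ge0 (Qinv X);
  have := normr_ge0 (S0inv X); lra.
Qed.

Lemma delta_eq0 (X : 'M[R]_(2 + 2)) : (delta X == 0) = (S0inv X == 0).
Proof.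
have := expf_eq0 (delta X) 2; rewrite delta_sqr /= => <-.
by rewrite eq_complex/= eqxx andbT.
Qed.

(** * Measurability and the pointwise bound *)

Section cmeasurable.
Context {d : measure_display} {T : measurableType d} (D : set T).

(** Componentwise form, matching the two measurability conjuncts of [L1loc]. *)
Definition cmeasurable (f : T -> R[i]) :=
  measurable_fun D (fun x => complex.Re (f x)) /\
  measurable_fun D (fun x => complex.Im (f x)).

Lemma cmeasurable_cst (z : R[i]) : cmeasurable (fun=> z).
Proof. by split; exact: measurable_cst. Qed.

Lemma cmeasurable_real (f : T -> R) :
  measurable_fun D f -> cmeasurable (fun x => (f x)%:C).
Proof. by move=> mf; split => //=; exact: measurable_cst. Qed.

Lemma cmeasurableD (f g : T -> R[i]) :
  cmeasurable f -> cmeasurable g -> cmeasurable (fun x => f x + g x).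
Proof.
move=> [f1 f2] [g1 g2]; split.
  by under eq_fun do rewrite ReD; exact: measurable_funD.
by under eq_fun do rewrite ImD; exact: measurable_funD.
Qed.

Lemma cmeasurableN (f : T -> R[i]) :
  cmeasurable f -> cmeasurable (fun x => - f x).
Proof.
move=> [f1 f2]; split.
  by under eq_fun do rewrite ReN; exact: measurable_funN.
by under eq_fun do rewrite ImN; exact: measurable_funN.
Qed.

Lemma cmeasurableM (f g : T -> R[i]) :
  cmeasurable f -> cmeasurable g -> cmeasurable (fun x => f x * g x).
Proof.
move=> [f1 f2] [g1 g2]; split.
  by under eq_fun do rewrite ReM; apply: measurable_funB; exact: measurable_funM.
by under eq_fun do rewrite ImM; apply: measurable_funD; exact: measurable_funM.
Qed.

Lemma cmeasurableX (f : T -> R[i]) n :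
  cmeasurable f -> cmeasurable (fun x => f x ^+ n).
Proof.
move=> mf; elim: n => [|n ih].
  by under eq_fun do rewrite expr0; exact: cmeasurable_cst.
by under eq_fun do rewrite exprS; exact: cmeasurableM.
Qed.

Lemma isqrt_sqr (x : R) : 0 <= x -> isqrt x ^+ 2 = x^-1.
Proof. by move=> x0; rewrite isqrtE ger0_norm// exprVn sqr_sqrtr. Qed.

Lemma cmeasurableV (f : T -> R[i]) :
  cmeasurable f -> cmeasurable (fun x => (f x)^-1).
Proof.
move=> [f1 f2].
have mn : measurable_fun D
    (fun x => (complex.Re (f x) ^+ 2 + complex.Im (f x) ^+ 2)^-1).
  (* The inverse of the squared modulus is expressed through [isqrt], already known to be
     measurable; both sides are 0 where [f] vanishes. *)
  have -> : (fun x => (complex.Re (f x) ^+ 2 + complex.Im (f x) ^+ 2)^-1) =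
    (fun x => isqrt (complex.Re (f x) ^+ 2 + complex.Im (f x) ^+ 2) ^+ 2).
    by apply/funext => x; rewrite isqrt_sqr// addr_ge0 ?sqr_ge0.
  apply: measurable_funX; apply: (measurableT_comp measurable_isqrt).
  by apply: measurable_funD; exact: measurable_funX.
split.
  have -> : (fun x => complex.Re (f x)^-1) = (fun x => complex.Re (f x) *
      (complex.Re (f x) ^+ 2 + complex.Im (f x) ^+ 2)^-1).
    by apply/funext => x; case: (f x).
  exact: measurable_funM.
have -> : (fun x => complex.Im (f x)^-1) = (fun x => - complex.Im (f x) *
    (complex.Re (f x) ^+ 2 + complex.Im (f x) ^+ 2)^-1).
  by apply/funext => x; case: (f x) => a b /=; rewrite mulNr.
by apply: measurable_funM => //; exact: measurable_funN.
Qed.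

(** The majorant may depend on the point, since pointwise convergence of the measurable partial sums
    suffices. *)
Lemma cmeasurable_csum (h : nat -> T -> R[i]) (b : T -> nat -> R) :
  (forall n, cmeasurable (h n)) ->
  (forall x n, cabs (h n x) <= b x n) -> (forall x, cvgn (series (b x))) ->
  cmeasurable (fun x => csum (h^~ x)).
Proof.
move=> mh hb vb; split.
  apply: (@measurable_fun_cvg _ _ _ _
    (fun m x => series (fun n => complex.Re (h n x)) m)).
    by move=> m; apply: measurable_sum => n; case: (mh n).
  move=> x _; rewrite (csumE (hb x) (vb x)) /=.
  apply: (is_cvg_series_dom _ (vb x)) => n.
  exact: le_trans (cabs_ge_Re _) (hb x n).
apply: (@measurable_fun_cvg _ _ _ _
  (fun m x => series (fun n => complex.Im (h n x)) m)).
  by move=> m; apply: measurable_sum => n; case: (mh n).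
move=> x _; rewrite (csumE (hb x) (vb x)) /=.
apply: (is_cvg_series_dom _ (vb x)) => n.
exact: le_trans (cabs_ge_Im _) (hb x n).
Qed.

Lemma cmeasurable_psum (c : nat -> R) (C : R) (lambda : R[i]) (f : T -> R[i]) :
  fact_growth c C -> cmeasurable f ->
  cmeasurable (fun x => psum c lambda (f x)).
Proof.
move=> cC mf.
apply: (@cmeasurable_csum
  (fun n x => (c n)%:C * (lambda * f x) ^+ n / (4 ^+ n * (n`!%:R) ^+ 2))
  (fun x n => C * exp_coeff (cabs lambda * cabs (f x)) n)).
- move=> n; apply: cmeasurableM; last exact: cmeasurable_cst.
  apply: cmeasurableM; first exact: cmeasurable_cst.
  apply: cmeasurableX; apply: cmeasurableM => //; exact: cmeasurable_cst.
- move=> x n; rewrite exprMn.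
  apply: le_trans (cabs_psum_term _ _ cC _) _.
    by rewrite cabsX.
  by rewrite /exp_coeff/= exprMn.
- by move=> x; exact: is_cvg_expM.
Qed.

Lemma cmeasurable_bracket (c c' : nat -> R) (C C' : R) (lambda lambda' : R[i])
    (f g : T -> R[i]) :
  fact_growth c C -> fact_growth c' C' -> cmeasurable f -> cmeasurable g ->
  cmeasurable (fun x => bracket (psum c lambda) (psum c' lambda') (f x) (g x)).
Proof.
move=> cC cC' mf mg; apply: cmeasurableD; last apply: cmeasurableN.
  by apply: cmeasurableM; [exact: (cmeasurable_psum _ cC)|exact: (cmeasurable_psum _ cC')].
by apply: cmeasurableM; [exact: (cmeasurable_psum _ cC)|exact: (cmeasurable_psum _ cC')].
Qed.

End cmeasurable.

Lemma fact_growth1 : fact_growth (fun=> 1) 1.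
Proof.
move=> n; rewrite normr1 mul1r mulr_ege1// ?exprn_ege1 ?ler1n ?fact_gt0//.
Qed.

Lemma measurable_sqrt : measurable_fun [set: R] (@Num.sqrt R).
Proof. by apply: continuous_measurable_fun; exact: sqrt_continuous. Qed.

(** By [u - v = delta] and [u * v = S], the denominator and the logarithm become explicit in the
    invariants. The identity holds for every matrix, with the default values of division and
    [ln]. *)
Lemma FsingE (lambda1 lambda2 : R[i]) :
  Fsing lambda1 lambda2 = fun X =>
  (bracket (psum (fun=> 1) lambda1) (psum (fun n => acoef n%:R) lambda2)
     (uinv X) (vinv X)
   + bracket (psum (fun n => acoef n%:R) lambda1) (psum (fun=> 1) lambda2)
     (uinv X) (vinv X)) / delta X
  + (ln `|Sinv X|)%:C
    * (bracket (psum (fun=> 1) lambda1) (psum (fun=> 1) lambda2)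
         (uinv X) (vinv X) / delta X).
Proof.
apply/funext => X; rewrite /Fsing /= uinv_sub_vinv uinv_mul_vinv cabs_real.
by rewrite (funext (Phi_psum lambda1)) (funext (Phi_psum lambda2)).
Qed.

Lemma cmeasurable_Fsing d (T : measurableType d) (X : T -> 'M[R]_(2 + 2))
    (lambda1 lambda2 : R[i]) :
  measurable_fun setT (fun p => Qinv (X p)) ->
  measurable_fun setT (fun p => Sinv (X p)) ->
  cmeasurable setT (fun p => Fsing lambda1 lambda2 (X p)).
Proof.
move=> mQ mS; rewrite FsingE.
have [C aC] := acoef_fact_growth.
have mS0 : measurable_fun setT (fun p => S0inv (X p)).
  apply: measurable_funB; first exact: measurable_funX.
  by apply: measurable_funM => //; exact: measurable_cst.
have md : cmeasurable setT (fun p => delta (X p)).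
  under [X in cmeasurable _ X]eq_fun do rewrite deltaE.
  split => /=; apply: (measurableT_comp measurable_sqrt) => //.
  exact: measurable_funN.
have mu : cmeasurable setT (fun p => uinv (X p)).
  apply: cmeasurableM; last exact: cmeasurable_cst.
  by apply: cmeasurableD => //; exact: cmeasurable_real.
have mv : cmeasurable setT (fun p => vinv (X p)).
  apply: cmeasurableM; last exact: cmeasurable_cst.
  by apply: cmeasurableD; [exact: cmeasurable_real|exact: cmeasurableN].
have b1 c C1 c' C1' l l' : fact_growth c C1 -> fact_growth c' C1' ->
    cmeasurable setT (fun p => bracket (psum c l) (psum c' l') (uinv (X p)) (vinv (X p))).
  by move=> h h'; exact: (cmeasurable_bracket _ _ h h').
have aC1 := fact_growth1.
apply: cmeasurableD.
  apply: cmeasurableM; last exact: cmeasurableV.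
  by apply: cmeasurableD; [exact: (b1 _ _ _ _ _ _ aC1 aC)|exact: (b1 _ _ _ _ _ _ aC aC1)].
apply: cmeasurableM.
  apply: cmeasurable_real; apply: (measurableT_comp (@measurable_ln R)).
  by apply: measurableT_comp => //; exact: normr_measurable.
by apply: cmeasurableM; [exact: (b1 _ _ _ _ _ _ aC1 aC1)|exact: cmeasurableV].
Qed.

(** Both sides come from [1 + y <= expR y]: at [y = ln x] for large [x], and at
    [y = ln (isqrt x) = - ln x / 2] for small [x]. *)
Lemma norm_ln_le (x : R) : 0 < x -> `|ln x| <= x + 2 * isqrt x.
Proof.
move=> x0.
have h1 : ln x <= x.
  by have := expR_ge1Dx (ln x); rewrite lnK ?posrE//; lra.
have h2 : - ln x <= 2 * isqrt x.
  have i0 : 0 < isqrt x by rewrite isqrtE invr_gt0 sqrtr_gt0 gtr0_norm.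
  have := expR_ge1Dx (ln (isqrt x)); rewrite lnK ?posrE//.
  by rewrite {1}/isqrt gtr0_norm// ln_powR; lra.
have := isqrt_ge0 x; rewrite ler_norml; lra.
Qed.

Lemma bounded_lip_le f (M B B' : R) : B <= B' ->
  bounded_lip f M B -> bounded_lip f M B'.
Proof.
move=> BB fB z w zM wM; have [h1 h2] := fB z w zM wM.
split; first exact: le_trans BB.
by rewrite (le_trans h2)// ler_wpM2r ?cabs_ge0.
Qed.

Lemma cabs_Fsing_le (lambda1 lambda2 : R[i]) (M : R) : 1 <= M ->
  exists2 K, 0 <= K & forall X : 'M[R]_(2 + 2),
    Sinv X * S0inv X != 0 -> `|Qinv X| + (1 + `|S0inv X|) <= M ->
    `|Sinv X| <= M -> cabs (Fsing lambda1 lambda2 X) <= K * isqrt (Sinv X).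
Proof.
move=> M1.
have [C aC] := acoef_fact_growth; have aC1 := fact_growth1.
have [B1 B10 h1] := psum_bounded_lip lambda1 aC1 M1.
have [B2 B20 h2] := psum_bounded_lip lambda2 aC1 M1.
have [B3 B30 h3] := psum_bounded_lip lambda1 aC M1.
have [B4 B40 h4] := psum_bounded_lip lambda2 aC M1.
pose B := B1 + B2 + B3 + B4.
have {}h1 : bounded_lip (psum (fun=> 1) lambda1) M B.
  by apply: bounded_lip_le h1; rewrite /B; lra.
have {}h2 : bounded_lip (psum (fun=> 1) lambda2) M B.
  by apply: bounded_lip_le h2; rewrite /B; lra.
have {}h3 : bounded_lip (psum (fun n => acoef n%:R) lambda1) M B.
  by apply: bounded_lip_le h3; rewrite /B; lra.
have {}h4 : bounded_lip (psum (fun n => acoef n%:R) lambda2) M B.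
  by apply: bounded_lip_le h4; rewrite /B; lra.
pose N := 2 * B ^+ 2.
have N0 : 0 <= N by rewrite mulr_ge0 ?sqr_ge0.
(* Each bracket quotient is at most [N]. With [s = |S| <= M] and [g = s^(-1/2)], one has
   [1 <= g * M] and [|ln s| <= s + 2 * g <= g * M^2 + 2 * g], so every contribution is a multiple of
   [g]. *)
exists (2 * N * M + N * (M ^+ 2 + 2)).
  have M0 : 0 <= M by exact: le_trans M1.
  by rewrite addr_ge0// ?mulr_ge0 ?addr_ge0 ?sqr_ge0.
move=> X; rewrite mulf_eq0 negb_or => /andP[S0 S00] QM SM.
have uv : uinv X != vinv X by rewrite -subr_eq0 uinv_sub_vinv delta_eq0.
have uM := le_trans (cabs_uinv_le X) QM.
have vM := le_trans (cabs_vinv_le X) QM.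
rewrite FsingE -uinv_sub_vinv mulrDl.
have k1 := bounded_lip_bracket h1 h4 uv uM vM.
have k2 := bounded_lip_bracket h3 h2 uv uM vM.
have k3 := bounded_lip_bracket h1 h2 uv uM vM.
apply: (le_trans (cabsD _ _)); rewrite cabsM cabs_real.
apply: (@le_trans _ _ (N + N + `|ln `|Sinv X| | * N)).
  rewrite lerD//; last by rewrite ler_wpM2l.
  by apply: (le_trans (cabsD _ _)); rewrite lerD.
have s0 : 0 < `|Sinv X| by rewrite normr_gt0.
have := norm_ln_le s0.
have -> : isqrt `|Sinv X| = isqrt (Sinv X) by rewrite /isqrt normr_id.
have gs : isqrt (Sinv X) * Num.sqrt `|Sinv X| = 1.
  by rewrite isqrtE mulVf// gt_eqF// sqrtr_gt0.
have sq := sqr_sqrtr (ltW s0).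
have g0 := isqrt_ge0 (Sinv X).
have r0 := sqrtr_ge0 `|Sinv X|.
move: s0 SM gs sq g0 r0; set s := `|Sinv X|; set g := isqrt _.
set r := Num.sqrt s; set l := `|ln s| => s0 sM gr r2 g0 r0 ls.
have rM : r <= M by nra.
have g1 : 1 <= g * M by rewrite -gr ler_wpM2l.
have sg : s <= g * M ^+ 2.
  by rewrite (le_trans sM)// expr2 mulrA ler_peMl// (le_trans _ M1).
have lN : l * N <= (g * M ^+ 2 + 2 * g) * N by rewrite ler_wpM2r//; lra.
have NN : 2 * N * 1 <= 2 * N * (g * M) by rewrite ler_wpM2l// mulr_ge0.
have -> : (2 * N * M + N * (M ^+ 2 + 2)) * g =
  2 * N * (g * M) + (g * M ^+ 2 + 2 * g) * N by ring.
by lra.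
Qed.

(** * The complement of the domain is null *)

Section coordinates.
Context {d : measure_display} {T : measurableType d}.

Lemma measurable_fun_fst d1 d2 (T1 : measurableType d1) (T2 : measurableType d2)
    (f : T -> T1 * T2) :
  measurable_fun setT f -> measurable_fun setT (fun x => (f x).1).
Proof. by move=> mf; exact: (measurableT_comp measurable_fst mf). Qed.

Lemma measurable_fun_snd d1 d2 (T1 : measurableType d1) (T2 : measurableType d2)
    (f : T -> T1 * T2) :
  measurable_fun setT f -> measurable_fun setT (fun x => (f x).2).
Proof. by move=> mf; exact: (measurableT_comp measurable_snd mf). Qed.

Lemma measurable_eq0 (f : T -> R) :
  measurable_fun setT f -> measurable [set x | f x = 0].
Proof. by move=> mf; rewrite -[X in measurable X]setTI; apply: (mf _ [set 0]). Qed.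

End coordinates.

Local Notation BR := (measurableTypeR R).

Lemma measurable_mdet d (T : measurableType d)
    (f : T -> (BR * BR) * (BR * BR)) :
  measurable_fun setT f -> measurable_fun setT (fun x => mdet (f x)).
Proof.
move=> mf.
have m1 := measurable_fun_fst mf; have m2 := measurable_fun_snd mf.
by apply: measurable_funB; apply: measurable_funM;
  (exact: measurable_fun_fst || exact: measurable_fun_snd).
Qed.

Lemma measurable_Sinv_qmx : measurable_fun setT (fun p : qcoord R => Sinv (qmx p)).
Proof.
under eq_fun do rewrite Sinv_qmx.
by apply: measurable_funM; apply: measurable_mdet;
  [exact: measurable_fst|exact: measurable_snd].
Qed.

Lemma measurable_Qinv_qmx : measurable_fun setT (fun p : qcoord R => Qinv (qmx p)).
Proof.
under eq_fun do rewrite Qinv_qmx.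
have mi : measurable_fun setT (fun p : qcoord R => p) by exact: measurable_id.
have mU := measurable_fun_fst mi; have mV := measurable_fun_snd mi.
have m1 := measurable_fun_fst mU; have m2 := measurable_fun_snd mU.
have m3 := measurable_fun_fst mV; have m4 := measurable_fun_snd mV.
apply: measurable_funD; [apply: measurable_funD; [apply: measurable_funD|]|];
  apply: measurable_funM;
  (exact: measurable_fun_fst || exact: measurable_fun_snd).
Qed.

Lemma measurable_S0inv_qmx :
  measurable_fun setT (fun p : qcoord R => S0inv (qmx p)).
Proof.
apply: measurable_funB.
  by apply: measurable_funX; exact: measurable_Qinv_qmx.
by apply: measurable_funM => //; exact: measurable_Sinv_qmx.
Qed.

(** The null set [A] collects the exceptional first coordinates, over which the section of [N] is
    not controlled; they contribute nothing to the integral of the measures of the sections. *)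
Lemma product_null d1 d2 (T1 : measurableType d1) (T2 : measurableType d2)
    (m1 : {sigma_finite_measure set T1 -> \bar R})
    (m2 : {sigma_finite_measure set T2 -> \bar R})
    (A : set T1) (N : set (T1 * T2)) :
  measurable A -> m1 A = 0%E -> measurable N ->
  (forall x, ~ A x -> m2 (xsection N x) = 0%E) -> (m1 \x m2)%E N = 0%E.
Proof.
move=> mA A0 mN N0.
rewrite /product_measure1 (ge0_negligible_integral mA)//.
- by apply: integral0_eq => x [_ /N0].
- exact: measurable_fun_xsection.
Qed.

Lemma lebesgue_measure_finite (A : set R) :
  finite_set A -> lebesgue_measure A = 0%E.
Proof. by move=> fA; exact/countable_lebesgue_measure0/finite_set_countable. Qed.

Lemma finite_linear_roots (a b : R) : a != 0 ->
  finite_set [set x | a * x + b = 0].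
Proof.
move=> a0; apply: (@sub_finite_set _ _ [set - b / a]); last exact: finite_set1.
by move=> x /= h; apply: (mulfI a0); rewrite [RHS]mulrC divfK//; lra.
Qed.

(** Given one root [y], the only other candidate is [- (b / a) - y], by the formula for the sum of
    the roots. *)
Lemma finite_quadratic_roots (a b c : R) : a != 0 ->
  finite_set [set x | a * x ^+ 2 + b * x + c = 0].
Proof.
move=> a0.
have [[y hy]|no] := pselect (exists y, a * y ^+ 2 + b * y + c = 0).
  apply: (@sub_finite_set _ _ ([set y] `|` [set - (b / a) - y])).
    move=> x /= hx; have [->|xy] := eqVneq x y; [by left|right].
    have xy0 : x - y != 0 by rewrite subr_eq0.
    apply: (mulfI xy0); apply: (mulfI a0).
    have -> : a * ((x - y) * (- (b / a) - y)) = (x - y) * (- b - a * y) by field.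
    by nra.
  by rewrite finite_setU; split; exact: finite_set1.
apply: (@sub_finite_set _ _ set0); last exact: finite_set0.
by move=> x hx; apply: no; exists x.
Qed.

Lemma leb2_fst0 : @leb2 R [set r | r.1 = 0] = 0%E.
Proof.
rewrite /leb2; apply: (@product_null _ _ BR BR lebesgue_measure lebesgue_measure [set 0]) => //.
- exact: lebesgue_measure_set1.
- by apply: measurable_eq0; exact: measurable_fst.
move=> x /= x0; rewrite (_ : xsection _ _ = set0) ?measure0//.
by apply/seteqP; split => // y; rewrite /xsection/= inE.
Qed.

(** For fixed first row and fixed [c], with [a != 0], the determinant is a nonconstant affine
    function of the last entry. The locus where that entry vanishes is included because the entry
    becomes a leading coefficient in the eight-dimensional case. *)
Lemma leb4_snd0_mdet0 : @leb4 R [set U | U.2.2 * mdet U = 0] = 0%E.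
Proof.
have mi : measurable_fun setT (fun p : (BR * BR) * (BR * BR) => p).
  exact: measurable_id.
have mN : measurable [set U : (BR * BR) * (BR * BR) | U.2.2 * mdet U = 0].
  apply: measurable_eq0; apply: measurable_funM; last exact: measurable_mdet.
  exact: measurable_fun_snd (measurable_fun_snd mi).
rewrite /leb4; apply: (@product_null _ _ _ _ (@leb2 R) (@leb2 R) [set r | r.1 = 0]) => //.
- by apply: measurable_eq0; exact: measurable_fst.
- exact: leb2_fst0.
move=> [a b] /= a0; rewrite /leb2.
apply: (@product_null _ _ BR BR lebesgue_measure lebesgue_measure set0) => //.
  exact: measurable_xsection.
move=> c _; apply: lebesgue_measure_finite.
apply: (@sub_finite_set _ _ ([set x | 1 * x + 0 = 0] `|`
    [set x | a * x + (- (b * c)) = 0])).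
  move=> x; rewrite /xsection/= inE/= inE/= /mdet/= => /eqP.
  rewrite mulf_eq0 => /orP[] /eqP h; [left|right] => //=.
  by rewrite mul1r addr0.
by rewrite finite_setU; split; apply: finite_linear_roots; rewrite ?oner_eq0//; apply/eqP.
Qed.

(** Fix [U] with nonzero last entry and determinant, and all entries of [V] but the last, [x], with
    first entry [e != 0]. Then [S] is affine in [x] with slope [det U * e], and [S0] is quadratic in
    [x] with leading coefficient [U.2.2 ^+ 2], so finitely many [x] remain. *)
Lemma leb8_SS0_eq0 :
  @leb8 R [set p | Sinv (qmx p) * S0inv (qmx p) = 0] = 0%E.
Proof.
have mN : measurable [set p : qcoord R | Sinv (qmx p) * S0inv (qmx p) = 0].
  apply: measurable_eq0; apply: measurable_funM.
    exact: measurable_Sinv_qmx.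
  exact: measurable_S0inv_qmx.
have mi : measurable_fun setT (fun p : (BR * BR) * (BR * BR) => p).
  exact: measurable_id.
rewrite /leb8; apply: (@product_null _ _ _ _ (@leb4 R) (@leb4 R) [set U | U.2.2 * mdet U = 0]) => //.
- apply: measurable_eq0; apply: measurable_funM; last exact: measurable_mdet.
  exact: measurable_fun_snd (measurable_fun_snd mi).
- exact: leb4_snd0_mdet0.
move=> U /eqP; rewrite mulf_eq0 negb_or => /andP[U22 U0]; rewrite /leb4.
apply: (@product_null _ _ _ _ (@leb2 R) (@leb2 R) [set r | r.1 = 0]) => //.
- by apply: measurable_eq0; exact: measurable_fst.
- exact: leb2_fst0.
- exact: measurable_xsection.
move=> [e f] /= /eqP e0; rewrite /leb2.
apply: (@product_null _ _ BR BR lebesgue_measure lebesgue_measure set0) => //.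
  by do 2! apply: measurable_xsection.
move=> g _; apply: lebesgue_measure_finite.
pose t := U.1.1 * e + U.1.2 * g + U.2.1 * f.
apply: (@sub_finite_set _ _ ([set x | e * x + (- (f * g)) = 0] `|`
    [set x | U.2.2 ^+ 2 * x ^+ 2 + (2 * U.2.2 * t - 4 * mdet U * e) * x +
      (t ^+ 2 + 4 * mdet U * f * g) = 0])).
  move=> x; rewrite /xsection/= inE/= inE/= inE/= /S0inv Sinv_qmx Qinv_qmx/=.
  move=> /eqP; rewrite !mulf_eq0 (negbTE U0) /= => /orP[] /eqP h; [left|right].
    by rewrite /= -h /mdet/=.
  by rewrite /= -[RHS]h /t /mdet /=; ring.
rewrite finite_setU; split; first exact: finite_linear_roots.
by apply: finite_quadratic_roots; rewrite expf_neq0.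
Qed.

(** * Integration over boxes *)

Lemma integral_prod_mul d1 d2 (T1 : measurableType d1) (T2 : measurableType d2)
    (m1 : {sigma_finite_measure set T1 -> \bar R})
    (m2 : {sigma_finite_measure set T2 -> \bar R}) (f : T1 -> R) (g : T2 -> R) :
  measurable_fun setT f -> measurable_fun setT g ->
  (forall x, 0 <= f x) -> (forall y, 0 <= g y) ->
  (\int[m1 \x m2]_z (f z.1 * g z.2)%:E =
   (\int[m1]_x (f x)%:E) * (\int[m2]_y (g y)%:E))%E.
Proof.
move=> mf mg f0 g0; rewrite fubini_tonelli1//=; last 2 first.
- apply/measurable_EFinP; apply: measurable_funM.
    exact: (measurableT_comp mf measurable_fst).
  exact: (measurableT_comp mg measurable_snd).
- by move=> x; rewrite lee_fin mulr_ge0.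
rewrite -ge0_integralZr//; last 3 first.
- exact/measurable_EFinP.
- by move=> x _; rewrite lee_fin.
- by apply: integral_ge0 => y _; rewrite lee_fin.
apply: eq_integral => x _; rewrite /fubini_F/=.
under eq_integral do rewrite EFinM.
rewrite ge0_integralZl_EFin//; first by move=> y _; rewrite lee_fin.
exact/measurable_EFinP.
Qed.

Section box.
Context (M : R) (M0 : 0 <= M).

Definition box1 (x : R) : R := \1_`[- M, M] x.

Definition box2 (r : R * R) : R := box1 r.1 * box1 r.2.

Definition box4 (U : (R * R) * (R * R)) : R := box2 U.1 * box2 U.2.

Lemma box1_ge0 x : 0 <= box1 x.
Proof. by rewrite /box1 indicE. Qed.

Lemma box2_ge0 r : 0 <= box2 r.
Proof. by rewrite mulr_ge0 ?box1_ge0. Qed.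

Lemma box4_ge0 U : 0 <= box4 U.
Proof. by rewrite mulr_ge0 ?box2_ge0. Qed.

Lemma box1E x : `|x| <= M -> box1 x = 1.
Proof.
by move=> xM; rewrite /box1 indicE mem_set//= in_itv/= -ler_norml.
Qed.

Lemma measurable_box1 : measurable_fun [set: R] box1.
Proof. by apply: measurable_indic; exact: measurable_itv. Qed.

Lemma measurable_box2 : measurable_fun [set: BR * BR] box2.
Proof.
apply: measurable_funM; apply: (measurableT_comp measurable_box1).
  exact: measurable_fst.
exact: measurable_snd.
Qed.

Lemma measurable_box4 : measurable_fun [set: (BR * BR) * (BR * BR)] box4.
Proof.
apply: measurable_funM; apply: (measurableT_comp measurable_box2).
  exact: measurable_fst.
exact: measurable_snd.
Qed.

Lemma integral_box1_isqrt (e : R) :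
  (\int[lebesgue_measure]_(x in [set: BR]) (box1 x * isqrt (x - e))%:E
   <= (2 * M + 8)%:E)%E.
Proof.
have MM : - M <= M by have := M0; lra.
have := integral_isqrt_le e MM; rewrite opprK (_ : M + M = 2 * M); last by ring.
apply: le_trans; rewrite [leRHS]integral_mkcond.
apply: ge0_le_integral_subset => // x _.
- by rewrite lee_fin mulr_ge0 ?box1_ge0 ?isqrt_ge0.
- by rewrite patchE; case: ifPn => // _; rewrite lee_fin isqrt_ge0.
- by rewrite patchE /box1 indicE; case: (_ \in _); rewrite ?mul1r ?mul0r.
Qed.

Lemma integral_box1 :
  (\int[lebesgue_measure]_(x in [set: BR]) (box1 x)%:E = (2 * M)%:E)%E.
Proof.
rewrite /box1 integral_indic//.
rewrite setIT /= lebesgue_measure_itv/= lte_fin.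
case: ifPn => [_|]; first by rewrite -EFinB; congr EFin; ring.
by rewrite -leNgt => MM; congr EFin; have := M0; lra.
Qed.

Lemma measurable_box4_isqrt_mdet :
  measurable_fun [set: (BR * BR) * (BR * BR)] (fun U => box4 U * isqrt (mdet U)).
Proof.
apply: measurable_funM; first exact: measurable_box4.
apply: (measurableT_comp measurable_isqrt).
by apply: measurable_mdet; exact: measurable_id.
Qed.

(* Integrating over the last entry first: for [a != 0],
   [|ad - bc| = |a| |d - bc/a|]. *)
Lemma integral_box4_row (r : BR * BR) : r.1 <> 0 ->
  (\int[@leb2 R]_s (box4 (r, s) * isqrt (mdet (r, s)))%:E
   <= (box2 r * isqrt r.1 * (2 * M * (2 * M + 8)))%:E)%E.
Proof.
move=> /eqP r0.
have mF : measurable_fun [set: BR * BR]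
    (fun s => box4 (r, s) * isqrt (mdet (r, s))).
  exact: (measurableT_comp measurable_box4_isqrt_mdet (pair1_measurable r)).
have F0 s : 0 <= box4 (r, s) * isqrt (mdet (r, s)).
  by rewrite mulr_ge0 ?box4_ge0 ?isqrt_ge0.
have K0 : 0 <= box2 r * isqrt r.1 by rewrite mulr_ge0 ?box2_ge0 ?isqrt_ge0.
rewrite /leb2 fubini_tonelli1; last 2 first.
- exact/measurable_EFinP.
- by move=> s; rewrite lee_fin.
apply: (@le_trans _ _ (\int[lebesgue_measure]_(c in [set: BR])
    ((box2 r * isqrt r.1 * (2 * M + 8))%:E * (box1 c)%:E))%E); last first.
  rewrite ge0_integralZl_EFin//; last 3 first.
  - by move=> x _; rewrite lee_fin box1_ge0.
  - by apply/measurable_EFinP; exact: measurable_box1.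
  - by rewrite mulr_ge0//; have := M0; lra.
  rewrite integral_box1 -EFinM lee_fin le_eqVlt; apply/orP; left; apply/eqP.
  by ring.
have fub0 c : (0 <= fubini_F lebesgue_measure
    (fun s : BR * BR => (box4 (r, s) * isqrt (mdet (r, s)))%:E) c)%E.
  by apply: integral_ge0 => x _; rewrite lee_fin.
apply: ge0_le_integral_subset => // c _.
  by rewrite -EFinM lee_fin mulr_ge0 ?box1_ge0// mulr_ge0//; have := M0; lra.
have -> : ((box2 r * isqrt r.1 * (2 * M + 8))%:E * (box1 c)%:E =
  (box2 r * isqrt r.1 * box1 c)%:E * (2 * M + 8)%:E)%E.
  by rewrite -!EFinM; congr EFin; ring.
apply: (@le_trans _ _ ((box2 r * isqrt r.1 * box1 c)%:E *
   \int[lebesgue_measure]_(x in [set: BR])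
     (box1 x * isqrt (x - r.2 * c / r.1))%:E)%E); last first.
  rewrite lee_wpmul2l ?lee_fin ?mulr_ge0 ?box1_ge0 ?box2_ge0 ?isqrt_ge0//.
  exact: integral_box1_isqrt.
rewrite -ge0_integralZl_EFin//; last 3 first.
- by move=> x _; rewrite lee_fin mulr_ge0 ?box1_ge0 ?isqrt_ge0.
- apply/measurable_EFinP; apply: measurable_funM; first exact: measurable_box1.
  apply: (measurableT_comp measurable_isqrt).
  by apply: measurable_funB => //; exact: measurable_cst.
- by rewrite !mulr_ge0 ?box1_ge0 ?box2_ge0 ?isqrt_ge0.
apply: ge0_le_integral_subset => // x _.
- by rewrite lee_fin.
- by rewrite -EFinM lee_fin !mulr_ge0 ?box1_ge0 ?box2_ge0 ?isqrt_ge0.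
have -> : mdet (r, (c, x)) = r.1 * (x - r.2 * c / r.1).
  by rewrite /mdet/=; field.
rewrite -EFinM lee_fin isqrtM /box4/= {2}/box2 /= le_eqVlt.
by apply/orP; left; apply/eqP; ring.
Qed.

(** Integrating out the second row leaves [|a|^(-1/2)] on a box, which is again integrable. The row
    estimate needs [a != 0], so the null set [a = 0] is removed first. *)
Lemma integral_box4_isqrt_mdet :
  (\int[@leb4 R]_U (box4 U * isqrt (mdet U))%:E < +oo)%E.
Proof.
have F0 U : 0 <= box4 U * isqrt (mdet U).
  by rewrite mulr_ge0 ?box4_ge0 ?isqrt_ge0.
have mF : measurable_fun [set: (BR * BR) * (BR * BR)]
    (fun U => (box4 U * isqrt (mdet U))%:E).
  by apply/measurable_EFinP; exact: measurable_box4_isqrt_mdet.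
rewrite /leb4 fubini_tonelli1//.
have mA : measurable [set r : BR * BR | r.1 = 0].
  by apply: measurable_eq0; exact: measurable_fst.
rewrite (@ge0_negligible_integral _ _ _ (@leb2 R) _ _ _ mA)//; last 3 first.
- exact: measurable_fun_fubini_tonelli_F.
- by move=> r _; apply: integral_ge0 => s _; rewrite lee_fin.
- exact: leb2_fst0.
have [C C0 CE] : exists2 C, 0 <= C & C = 2 * M * (2 * M + 8).
  by eexists; last reflexivity; rewrite mulr_ge0//; have := M0; lra.
(* Writing [r.1 - 0] lets the translated one-dimensional estimate apply with centre 0. *)
have G0 (r : BR * BR) : 0 <= box1 r.1 * isqrt (r.1 - 0) * (box1 r.2 * C).
  by rewrite !mulr_ge0 ?box1_ge0 ?isqrt_ge0.
apply: (@le_lt_trans _ _ (\int[@leb2 R]_r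
    (box1 r.1 * isqrt (r.1 - 0) * (box1 r.2 * C))%:E)%E).
  apply: ge0_le_integral_subset => //.
  - by move=> r _; apply: integral_ge0 => s _; rewrite lee_fin.
  - by move=> r _; rewrite lee_fin.
  move=> r [_ /= r0]; apply: (le_trans (integral_box4_row r0)).
  rewrite lee_fin /box2 subr0 CE le_eqVlt; apply/orP; left; apply/eqP.
  by ring.
rewrite /leb2 (@integral_prod_mul _ _ BR BR lebesgue_measure lebesgue_measure
  (fun x => box1 x * isqrt (x - 0)) (fun x => box1 x * C)); last 4 first.
- apply: measurable_funM; first exact: measurable_box1.
  apply: (measurableT_comp measurable_isqrt).
  by apply: measurable_funB => //; exact: measurable_cst.
- by apply: measurable_funM; [exact: measurable_box1|exact: measurable_cst].
- by move=> x; rewrite mulr_ge0 ?box1_ge0 ?isqrt_ge0.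
- by move=> x; rewrite mulr_ge0 ?box1_ge0.
under [X in (_ * X)%E]eq_integral do rewrite EFinM.
rewrite ge0_integralZr//; last 2 first.
- by apply/measurable_EFinP; exact: measurable_box1.
- by move=> x _; rewrite lee_fin box1_ge0.
rewrite integral_box1 -EFinM.
apply: (@le_lt_trans _ _ ((2 * M + 8)%:E * (2 * M * C)%:E)%E); last first.
  by rewrite -EFinM ltry.
rewrite lee_wpmul2r ?lee_fin ?mulr_ge0//.
exact: integral_box1_isqrt.
Qed.

(** Since [S = det U * det V] and [isqrt] is multiplicative, the integral is the square of the
    four-dimensional one. *)
Lemma integral_box8_isqrt_Sinv :
  (\int[@leb8 R]_p (box4 p.1 * box4 p.2 * isqrt (Sinv (qmx p)))%:E < +oo)%E.
Proof.
under eq_integral do rewrite Sinv_qmx isqrtM mulrACA.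
rewrite /leb8 (@integral_prod_mul _ _ _ _ (@leb4 R) (@leb4 R)
  (fun U => box4 U * isqrt (mdet U)) (fun U => box4 U * isqrt (mdet U)));
  last 4 first.
- exact: measurable_box4_isqrt_mdet.
- exact: measurable_box4_isqrt_mdet.
- by move=> U; rewrite mulr_ge0 ?box4_ge0 ?isqrt_ge0.
- by move=> U; rewrite mulr_ge0 ?box4_ge0 ?isqrt_ge0.
have I0 : (0 <= \int[@leb4 R]_U (box4 U * isqrt (mdet U))%:E)%E.
  by apply: integral_ge0 => U _; rewrite lee_fin mulr_ge0 ?box4_ge0 ?isqrt_ge0.
by rewrite lte_mul_pinfty ?integral_box4_isqrt_mdet// ge0_fin_numE// integral_box4_isqrt_mdet.
Qed.

End box.

(** * Invariance and conclusion *)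

Lemma Qinv_conj (h X : 'M[R]_(2 + 2)) : h \in unitmx ->
  Qinv (h *m X *m invmx h) = Qinv X.
Proof.
move=> hU; rewrite /Qinv.
have -> : h *m X *m invmx h *m (h *m X *m invmx h) = h *m (X *m X) *m invmx h.
  by rewrite !mulmxA mulmxKV.
by rewrite mxtrace_mulC mulKmx.
Qed.

Lemma Sinv_conj (h X : 'M[R]_(2 + 2)) : h \in unitmx ->
  Sinv (h *m X *m invmx h) = Sinv X.
Proof.
by move=> hU; rewrite /Sinv !det_mulmx det_inv mulrC mulrA mulVr ?mul1r//.
Qed.

Lemma Fsing_conj (lambda1 lambda2 : R[i]) (h X : 'M[R]_(2 + 2)) :
  h \in unitmx -> Fsing lambda1 lambda2 (h *m X *m invmx h) = Fsing lambda1 lambda2 X.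
Proof.
move=> hU; rewrite /Fsing /uinv /vinv /delta /S0inv.
by rewrite Qinv_conj// Sinv_conj.
Qed.

Lemma Hgrp_unitmx (h : 'M[R]_(2 + 2)) : Hgrp h -> h \in unitmx.
Proof. by move=> [A [B [AU BU ->]]]; rewrite block_diag_mx_unit AU BU. Qed.

Lemma qspace_conj (h X : 'M[R]_(2 + 2)) :
  Hgrp h -> qspace X -> qspace (h *m X *m invmx h).
Proof.
move=> [A [B [AU BU ->]]] [U [V ->]].
exists (A *m U *m invmx B), (B *m V *m invmx A).
rewrite invmx_block_diag ?block_diag_mx_unit ?AU ?BU//.
by rewrite !mulmx_block !(mul0mx, mulmx0, addr0, add0r).
Qed.

Lemma Hinvariant_Fsing (lambda1 lambda2 : R[i]) :
  Hinvariant (@qreg R) (Fsing lambda1 lambda2).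
Proof.
move=> h X hH [qX SX]; have hU := Hgrp_unitmx hH.
split; last exact: Fsing_conj.
split; first exact: qspace_conj.
by rewrite /S0inv Sinv_conj// Qinv_conj.
Qed.

Lemma qreg_qmx (p : qcoord R) :
  qreg (qmx p) <-> Sinv (qmx p) * S0inv (qmx p) <> 0.
Proof.
split; first by move=> [_ /eqP].
by move=> /eqP h; split => //; exists (mx2 p.1), (mx2 p.2).
Qed.

Lemma normr_mul_le (x y a b : R) :
  `|x| <= a -> `|y| <= b -> `|x * y| <= a * b.
Proof. by move=> xa yb; rewrite normrM ler_pM. Qed.

Lemma normr_mdet_le (M : R) (U : (R * R) * (R * R)) :
  `|U.1.1| <= M -> `|U.1.2| <= M -> `|U.2.1| <= M -> `|U.2.2| <= M ->
  `|mdet U| <= 2 * M ^+ 2.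
Proof.
move=> h1 h2 h3 h4; rewrite (le_trans (ler_normB _ _))//.
have -> : 2 * M ^+ 2 = M * M + M * M by ring.
by rewrite lerD// normr_mul_le.
Qed.

Lemma compact_qcoord_bounded (K : set (qcoord R)) :
  compact (K : set (((R * R) * (R * R)) * ((R * R) * (R * R)))%type) ->
  exists2 M : R, 0 <= M & forall p, K p ->
    [/\ [/\ `|p.1.1.1| <= M, `|p.1.1.2| <= M, `|p.1.2.1| <= M & `|p.1.2.2| <= M] &
        [/\ `|p.2.1.1| <= M, `|p.2.1.2| <= M, `|p.2.2.1| <= M & `|p.2.2.2| <= M]].
Proof.
move=> cK; have [M [_ KM]] := compact_bounded cK.
(* Boundedness provides the estimate for every radius strictly above [M]; this one is moreover
   nonnegative. The norm of a product is the maximum, so all eight coordinates obey it. *)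
exists (`|M| + 1); first by rewrite addr_ge0.
move=> p Kp.
have MM : M < `|M| + 1 by rewrite (le_lt_trans (ler_norm _))// ltrDl.
have := KM _ MM _ Kp; rewrite /= !prod_normE/= !ge_max.
by move=> /andP[/andP[/andP[-> ->] /andP[-> ->]] /andP[/andP[-> ->] /andP[-> ->]]].
Qed.

Lemma Fsing_integrable_compact (lambda1 lambda2 : R[i]) (K : set (qcoord R)) :
  compact (K : set (((R * R) * (R * R)) * ((R * R) * (R * R)))%type) ->
  (\int[@leb8 R]_(p in K `&` @qmx R @^-1` @qreg R)
     (cabs (Fsing lambda1 lambda2 (qmx p)))%:E < +oo)%E.
Proof.
move=> cK; have [m m0 Km] := compact_qcoord_bounded cK.
(* For coordinates bounded by [m]: [|Q| <= 4 * m^2], [|S| <= 4 * m^4] and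
   [|S0| <= Q^2 + 4 * |S| <= 32 * m^4]. Thus [M] exceeds both [|Q| + 1 + |S0|] and [|S|]. *)
pose M := 1 + 4 * m ^+ 2 + 36 * m ^+ 4.
have m2 : 0 <= m ^+ 2 by rewrite exprn_ge0.
have m4 : 0 <= m ^+ 4 by rewrite exprn_ge0.
have M1 : 1 <= M by rewrite /M; lra.
have [C C0 FC] := cabs_Fsing_le lambda1 lambda2 M1.
have G0 (p : qcoord R) : 0 <= box4 m p.1 * box4 m p.2 * isqrt (Sinv (qmx p)).
  by rewrite !mulr_ge0 ?box4_ge0 ?isqrt_ge0.
have mG : measurable_fun setT
    (fun p : qcoord R => box4 m p.1 * box4 m p.2 * isqrt (Sinv (qmx p))).
  apply: measurable_funM.
    apply: measurable_funM; apply: (measurableT_comp (measurable_box4 m)).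
      exact: measurable_fst.
    exact: measurable_snd.
  exact: (measurableT_comp measurable_isqrt measurable_Sinv_qmx).
apply: (@le_lt_trans _ _ (\int[@leb8 R]_p
    (C%:E * (box4 m p.1 * box4 m p.2 * isqrt (Sinv (qmx p)))%:E))%E); last first.
  rewrite ge0_integralZl_EFin//; last 2 first.
  - by move=> p _; rewrite lee_fin.
  - exact/measurable_EFinP.
  by rewrite lte_mul_pinfty// integral_box8_isqrt_Sinv.
apply: ge0_le_integral_subset => //.
- by move=> p _; rewrite lee_fin cabs_ge0.
- by move=> p _; rewrite -EFinM lee_fin mulr_ge0.
move=> p [/Km [[a1 a2 a3 a4] [b1 b2 b3 b4]]] /qreg_qmx/eqP SS.
have b1E U : `|U.1.1| <= m -> `|U.1.2| <= m -> `|U.2.1| <= m ->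
    `|U.2.2| <= m -> box4 m U = 1.
  by move=> h1 h2 h3 h4; rewrite /box4 /box2 !box1E// !mulr1.
rewrite -EFinM lee_fin !b1E// !mul1r.
have Sm : `|Sinv (qmx p)| <= 4 * m ^+ 4.
  rewrite Sinv_qmx; have -> : 4 * m ^+ 4 = (2 * m ^+ 2) * (2 * m ^+ 2) by ring.
  by rewrite normr_mul_le// normr_mdet_le.
have Qm : `|Qinv (qmx p)| <= 4 * m ^+ 2.
  rewrite Qinv_qmx; have -> : 4 * m ^+ 2 = m * m + m * m + m * m + m * m by ring.
  do 3! (apply: (le_trans (ler_normD _ _)); apply: lerD;
    last exact: normr_mul_le).
  exact: normr_mul_le.
have S0m : `|S0inv (qmx p)| <= 32 * m ^+ 4.
  rewrite /S0inv (le_trans (ler_normB _ _))//.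
  have -> : 32 * m ^+ 4 = (4 * m ^+ 2) * (4 * m ^+ 2) + 4 * (4 * m ^+ 4) by ring.
  by rewrite expr2 lerD// normr_mul_le// normr_nat.
by apply: FC => //; rewrite /M; lra.
Qed.

Lemma L1loc_Fsing (lambda1 lambda2 : R[i]) :
  L1loc (@qreg R) (Fsing lambda1 lambda2).
Proof.
have mN : measurable [set p : qcoord R | Sinv (qmx p) * S0inv (qmx p) = 0].
  apply: measurable_eq0; apply: measurable_funM.
    exact: measurable_Sinv_qmx.
  exact: measurable_S0inv_qmx.
have EE : @qmx R @^-1` @qreg R =
    ~` [set p : qcoord R | Sinv (qmx p) * S0inv (qmx p) = 0].
  by apply/seteqP; split => p /= /qreg_qmx.
have [mRe mIm] := cmeasurable_Fsing lambda1 lambda2 measurable_Qinv_qmx measurable_Sinv_qmx.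
split.
- by rewrite EE; exact: measurableC.
- rewrite EE setCK; apply/negligibleP => //; exact: leb8_SS0_eq0.
- exact: measurable_funTS.
- exact: measurable_funTS.
- exact: Fsing_integrable_compact.
Qed.

End local_integrability.

Theorem proposition5p3p1 (R : realType) (lambda1 lambda2 : R[i])
    (Hlambda : lambda1 * lambda2 * (lambda1 - lambda2) != 0) :
  L1loc (@qreg R) (Fsing lambda1 lambda2) /\
  Hinvariant (@qreg R) (Fsing lambda1 lambda2).
Proof.
by split; [exact: L1loc_Fsing|exact: Hinvariant_Fsing].
Qed.
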